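(* Let $V$ be a finite-dimensional real inner product space and let $\mathcal{H}$ be a Coxeter arrangement in $V$ such that $|\mathcal{H}|\geq \dim(V)$. Let $a\in V$ and $R\geq \|a\|$ (equivalently, the closed ball $\mathbb{B}(a,R)=\{x\in V:\|x-a\|\leq R\}$ contains the origin). (i) If $|\mathcal{H}|>\dim(V)$ and $|\mathcal{H}|\equiv \dim(V) \pmod 2$, then $P(\mathcal{H},\mathbb{B}(a,R))=0$. (ii) If $|\mathcal{H}|>\dim(V)$ and $|\mathcal{H}|\not\equiv \dim(V)\pmod 2$, then for fixed $a$, $P(\mathcal{H},\mathbb{B}(a,R))\to 0$ as $R\to+\infty$. (iii) If $|\mathcal{H}|=\dim(V)$, then $P(\mathcal{H},\mathbb{B}(a,R))$ does not depend on $R$ (for $R\geq\|a\|$).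
   Context: Let $V$ be a real inner product space of dimension $n$ with inner product $(\cdot,\cdot)$. A (central) hyperplane arrangement $\mathcal{H}$ in $V$ is given by a finite set $E$ of unit vectors, no two of which are linearly dependent, via $\mathcal{H}=\{H_e:e\in E\}$ with $H_e=\{x\in V:(e,x)=0\}$; $|\mathcal{H}|=|E|$. Chambers are the connected components of $V\setminus\bigcup_{e\in E}H_e$. It is assumed that there is a base chamber $T_0$ on which $(e,x)>0$ for all $e\in E$. For a chamber $T$, $(-1)^T=(-1)^s$ where $s$ is the number of $e\in E$ such that $T$ and $T_0$ lie on opposite sides of $H_e$. $\mathrm{Vol}$ is Lebesgue measure on $V$ (transported by any linear isometry $V\cong\mathbb{R}^n$). For a measurable $K\subseteq V$ of finite volume, the pizza quantity is $P(\mathcal{H},K)=\sum_{T}(-1)^T\,\mathrm{Vol}(K\cap T)$, the sum over all chambers $T$. $\mathcal{H}$ is a Coxeter arrangement if the group $W$ generated by the orthogonal reflections in the hyperplanes $H_e$, $e\in E$, is finite and each such reflection maps every hyperplane of $\mathcal{H}$ to a hyperplane of $\mathcal{H}$; $W$ is called its Coxeter group. *)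

(* Defs.v *)
From HB Require Import structures.
From mathcomp Require Import all_boot all_order all_algebra finmap.
From mathcomp Require Import all_classical all_reals all_analysis.

Set Implicit Arguments.
Unset Strict Implicit.
Unset Printing Implicit Defensive.

Import Order.TTheory GRing.Theory Num.Theory.
Import numFieldNormedType.Exports.

Local Open Scope classical_set_scope.
Local Open Scope ring_scope.

(* Finite-dimensional normed spaces. A real inner product space is such a V
   together with [dot : {dot V for idfun}] and [inner_norm dot]. *)
#[short(type="normedVectType")]
HB.structure Definition NormedVector (R : numFieldType) :=
  {V of NormedModule R V & Vector R V}.

(* Lebesgue measure on R^n as the iterated product measure, with the point mass
   on R^0. This is an honest measure only on the Borel (product) sigma-algebra;
   its values on other sets are not meaningful. *)
Fixpoint lebesgue_tuple (R : realType) (n : nat) : set (n.-tuple R) -> \bar R :=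
  match n with
  | 0 => fun A => \d_([tuple] : 0.-tuple R) A
  | m.+1 => fun A => (@lebesgue_measure R \x lebesgue_tuple (n := m))%E
      [set p : R * m.-tuple R | A [tuple of p.1 :: p.2]]
  end.

Section arrangements.
Context {R : realType} {V : normedVectType R}.
Variable dot : {dot V for idfun}.
Implicit Types (E : {fset V}) (T K : set V) (e x : V).

Definition inner_norm : Prop := forall x, `|x| = Num.sqrt (dot x x).

Definition hyperplane e : set V := [set x | dot e x = 0].

Definition is_arrangement E : Prop :=
  (forall e, e \in E -> `|e| = 1) /\
  (forall e f, e \in E -> f \in E -> e != f -> free [:: e; f]).

Definition complement E : set V := ~` \bigcup_(e in [set` E]) hyperplane e.

Definition chambers E : set (set V) :=
  [set connected_component (complement E) x | x in complement E].

Definition is_base_chamber E T0 : Prop :=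
  chambers E T0 /\ forall e x, e \in E -> T0 x -> 0 < dot e x.

Definition opposite_sides e T T' : Prop :=
  let pos := [set x | 0 < dot e x] in let neg := [set x | dot e x < 0] in
  (T `<=` pos /\ T' `<=` neg) \/ (T `<=` neg /\ T' `<=` pos).

Definition chamber_sign E T0 T : R :=
  (-1) ^+ #|` [fset e in E | `[< opposite_sides e T T0 >]]%fset|.

(* For an orthonormal basis b, t |-> \sum_i t_i *: b_i is a linear isometry
   from R^n onto V; Vol b is Lebesgue measure transported along it. *)
Definition Vol (b : (\dim {:V}).-tuple V) (A : set V) : \bar R :=
  lebesgue_tuple [set t : (\dim {:V}).-tuple R |
    A (\sum_(i < \dim {:V}) tnth t i *: tnth b i)].

(* The base chamber T0 is unique when it exists; it enters only through the
   signs. *)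
Definition pizza (b : (\dim {:V}).-tuple V) E T0 K : R :=
  \sum_(T \in chambers E) chamber_sign E T0 T * fine (Vol b (K `&` T)).

Definition reflection e x : V := x - (2 * dot e x / dot e e) *: e.

Definition is_transformation_group (G : set (V -> V)) : Prop :=
  [/\ G id,
      forall f g, G f -> G g -> G (f \o g) &
      forall f, G f -> exists2 g, G g & cancel f g /\ cancel g f].

Definition Coxeter_group E : set (V -> V) :=
  smallest is_transformation_group [set reflection e | e in [set` E]].

Definition is_Coxeter_arrangement E : Prop :=
  [/\ is_arrangement E,
      finite_set (Coxeter_group E) &
      forall e f, e \in E -> f \in E ->
        exists2 g, g \in E & reflection e @` hyperplane f = hyperplane g].

(* Not the library's [closed_ball], which is the closure of the open ball and
   is therefore empty for r = 0. *)
Definition cball (a : V) (r : R) : set V := [set x | `|x - a| <= r].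

End arrangements.

(* Main.v *)
(** Let [sigma x] be the product over [e] in [E] of the signs of [(e, x)]. Then
    the pizza quantity of [K] is the integral of [sigma] over [K]. A ball
    containing the origin is star-shaped about it, with radial function
    [rho x = t + sqrt (t^2 + c)], where [t = (a, x) / |x|] and
    [c = R^2 - |a|^2]; in polar coordinates the integral over the ball becomes
    the integral of [sigma * rho^n] over the unit ball.

    The moment [a |-> int sigma t^k] is a homogeneous polynomial of degree [k]
    in [a] which vanishes on every hyperplane, because each reflection changes
    the sign of [sigma]; hence it is zero for [k < |E|]. If [|E|] and [n] have
    the same parity, averaging over [x] and [-x] replaces [rho^n] by half of
    [(t + sqrt (t^2 + c))^n + (t - sqrt (t^2 + c))^n], a polynomial in [t] of
    degree at most [n] whose coefficient of [t^n] does not depend on [c]. This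
    gives (i) and (iii). In general [rho^n] is a polynomial of degree at most
    [n] in [t] up to an error [O(1 / sqrt c)], which gives (ii).

    Rotation invariance of Lebesgue measure comes from the uniqueness of
    translation-invariant measures, and the polar formula from the scaling of
    the measure of a cone, applied to the level sets of a discretisation of
    [rho]. *)
Require Import Defs.
From HB Require Import structures.
From mathcomp Require Import all_boot all_order all_algebra finmap.
From mathcomp Require Import all_classical all_reals all_analysis.
From mathcomp Require Import measurable_realfun ring lra.

Set Implicit Arguments.
Unset Strict Implicit.
Unset Printing Implicit Defensive.

Import Order.TTheory GRing.Theory Num.Theory.
Import numFieldNormedType.Exports.

Local Open Scope classical_set_scope.
Local Open Scope ring_scope.

(** * Lebesgue measure on tuples *)

Section sigma_finite_pushforward.
Context d d' (T : measurableType d) (T' : measurableType d') (R : realType).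
Variables (mu : {measure set T -> \bar R}).
Hypothesis mu_sf : sigma_finite setT mu.
Variables (f : T -> T') (g : T' -> T).
Hypotheses (mf : measurable_fun [set: T] f) (mg : measurable_fun [set: T'] g).
Hypothesis fK : cancel f g.

Let nu := pushforward mu f.

HB.instance Definition _ := Measure.copy nu
  (measure_function_pushforward__canonical__measure_function_Measure mu mf).

(** A pushforward of a sigma-finite measure can fail to be sigma-finite. Here the left inverse [g]
    pulls an exhaustion back to the target, and the [f]-preimage of each pulled-back set is the
    original set. *)
Let nu_sigma_finite : sigma_finite setT nu.
Proof.
have [F TF Foo] := mu_sf.
exists (fun n => g @^-1` F n).
  by rewrite -preimage_bigcup -TF preimage_setT.
move=> k; have [? ?] := Foo k; split.
  by rewrite -[X in measurable X]setTI; exact: mg.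
rewrite /nu /= /pushforward -comp_preimage.
by rewrite (_ : g \o f = id)//; apply/funext => x /=; rewrite fK.
Qed.

HB.instance Definition _ := Measure_isSigmaFinite.Build _ _ _ nu nu_sigma_finite.

Lemma sigma_finite_pushforward :
  exists nu : {sigma_finite_measure set T' -> \bar R},
    forall A, nu A = mu (f @^-1` A).
Proof. by exists nu. Qed.

End sigma_finite_pushforward.

Lemma sigma_finite_product_measure d d' (T : measurableType d)
    (T' : measurableType d') (R : realType)
    (m1 : {sigma_finite_measure set T -> \bar R})
    (m2 : {sigma_finite_measure set T' -> \bar R}) :
  sigma_finite setT (m1 \x m2)%E.
Proof.
have /sigma_finiteP[F [TF ndF Foo]] := sigma_finiteT m1.
have /sigma_finiteP[G [TG ndG Goo]] := sigma_finiteT m2.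
(* Both exhaustions are nondecreasing, so the two coordinates meet at the index [maxn i j]. *)
exists (fun n => F n `*` G n) => [|n].
  apply/esym; rewrite -subTset => -[x y] _.
  have [i _ Fix] : (\bigcup_i F i) x by rewrite -TF.
  have [j _ Gjy] : (\bigcup_j G j) y by rewrite -TG.
  exists (maxn i j) => //; split => /=.
    by apply: (subsetPset _ _ (ndF _ _ (leq_maxl i j))).
  by apply: (subsetPset _ _ (ndG _ _ (leq_maxr i j))).
have [mF Fn] := Foo n; have [mG Gn] := Goo n.
split; first exact: measurableX.
by rewrite product_measure1E// lte_mul_pinfty// ge0_fin_numE.
Qed.

Section lebesgue_tuple_measure.
Context {R : realType}.

Local Notation mR := (measurableTypeR R).

Lemma measurable_cons_pair n : measurable_fun [set: mR * n.-tuple R]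
  (fun p : mR * n.-tuple R => [tuple of p.1 :: p.2] : n.+1.-tuple R).
Proof.
exact: (@measurable_cons _ _ (mR * n.-tuple R)%type R
  (@fst mR (n.-tuple R)) n (@snd mR (n.-tuple R))).
Qed.

(** [lebesgue_tuple] is a bare set function; identifying it with a bundled measure gives access to
    Fubini. The inductive step pushes the product measure forward along [cons], which is inverted by
    head and tail. *)
Lemma lebesgue_tuple_sigma_finite_measure n :
  exists mu : {sigma_finite_measure set (n.-tuple R) -> \bar R},
    forall A, mu A = @lebesgue_tuple R n A.
Proof.
elim: n => [|n [mu IH]].
  by exists (dirac ([tuple] : 0.-tuple R)).
have mg : measurable_fun setT
    (fun t : n.+1.-tuple R => (thead t, [tuple of behead t]) : mR * n.-tuple R).
  apply/measurable_fun_pair; last exact: measurable_behead.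
  exact: (@measurable_tnth _ R n.+1 ord0).
have cK : cancel (fun p : mR * n.-tuple R => [tuple of p.1 :: p.2] : n.+1.-tuple R)
    (fun t : n.+1.-tuple R => (thead t, [tuple of behead t])).
  by move=> [x t] /=; rewrite theadE; congr pair; exact: val_inj.
have [nu nuE] := sigma_finite_pushforward
  (sigma_finite_product_measure (@lebesgue_measure R) mu)
  (@measurable_cons_pair n) mg cK.
exists nu => A; rewrite nuE /=; apply: eq_integral => x _ /=.
by rewrite IH.
Qed.

Lemma measurable_affine (k v : R) : measurable_fun [set: R] (fun x : R => k * x + v).
Proof. by apply: measurable_funD => //; exact: measurable_funM. Qed.

(** The right-hand side is a scaled pushforward, hence a measure. It agrees with length on half-open
    intervals, and uniqueness of Lebesgue measure concludes. *)
Lemma lebesgue_measure_affine (k v : R) (A : set R) : 0 < k -> measurable A ->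
  lebesgue_measure A = (k%:E * lebesgue_measure ((fun x => (k * x + v)%R) @^-1` A))%E.
Proof.
move=> k0 mA.
have mf : measurable_fun [set: mR] (fun x : mR => k * x + v : mR).
  by exact: measurable_affine.
pose nu0 : {measure set (mR) -> \bar R} :=
  measure_function_pushforward__canonical__measure_function_Measure lebesgue_measure mf.
pose nu : {measure set (mR) -> \bar R} := mscale (NngNum (ltW k0)) nu0.
rewrite -[RHS]/(nu A); apply: lebesgue_measure_unique => // _ [[a b]] _ <-.
rewrite -[RHS]/(k%:E * lebesgue_measure ((fun x => (k * x + v)%R) @^-1` [set` `]a, b]]))%E.
rewrite [X in _ = (_ * _ X)%E](_ : _ = [set` `]((a - v) / k), ((b - v) / k)]]); last first.
  apply/seteqP; split => x /=; rewrite !in_itv/= ltr_pdivrMr// ler_pdivlMr//;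
  by rewrite ltrBlDr lerBrDr mulrC.
rewrite !lebesgue_measure_itv/= !lte_fin.
rewrite ltr_pM2r ?invr_gt0// ltrD2r.
case: ifP => ab; last by rewrite mule0.
rewrite -!EFinB -EFinM; congr EFin.
by field; rewrite gt_eqF.
Qed.

Definition tuple_affine n (k : R) (v t : n.-tuple R) : n.-tuple R :=
  [tuple k * tnth t i + tnth v i | i < n].

(** Induction through sections: the change of variable in the first coordinate contributes one
    factor [k], and the induction hypothesis on each section contributes [k ^+ n]. *)
Lemma lebesgue_tuple_affine n (k : R) (v : n.-tuple R) (A : set (n.-tuple R)) :
  0 < k -> measurable A ->
  lebesgue_tuple A = ((k ^+ n)%:E * lebesgue_tuple (tuple_affine k v @^-1` A))%E.
Proof.
move=> k0; elim: n v A => [|n IH] v A mA.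
  rewrite expr0 mul1e /=; congr (dirac _ _); apply/seteqP.
  by split => t; rewrite /= [t]tuple0 [tuple_affine _ _ _]tuple0.
have [mu muE] := lebesgue_tuple_sigma_finite_measure n.
pose A' := [set p : R * n.-tuple R | A [tuple of p.1 :: p.2]].
have mA' : measurable A'.
  by rewrite -[X in measurable X]setTI; exact: measurable_cons_pair.
pose f x := mu (xsection A' x).
have mf : measurable_fun setT f by exact: measurable_fun_xsection.
have -> : lebesgue_tuple A = (\int[lebesgue_measure]_x f x)%E.
  by apply: eq_integral => x _ /=; rewrite /f muE.
pose v' : n.-tuple R := [tuple of behead v].
(* The section over [x] of the preimage is the preimage of the section over [k * x + thead v]. *)
have -> : lebesgue_tuple (tuple_affine k v @^-1` A) =
    (\int[lebesgue_measure]_x lebesgue_tuple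
      (tuple_affine k v' @^-1` xsection A' (k * x + thead v)%R))%E.
  apply: eq_integral => x _ /=; congr lebesgue_tuple.
  apply/seteqP; split => t; rewrite /xsection /= !in_setE /A' /=.
    congr A; apply: eq_from_tnth => i; rewrite tnth_mktuple.
    case: (unliftP ord0 i) => [j|] ->; rewrite ?tnthS ?tnth_mktuple//.
    by rewrite [v in LHS]tuple_eta tnthS.
  congr A; apply: eq_from_tnth => i; rewrite tnth_mktuple.
  case: (unliftP ord0 i) => [j|] ->; rewrite ?tnthS ?tnth_mktuple//.
  by rewrite [v in RHS]tuple_eta tnthS.
have mh : measurable_fun [set: mR] (fun x : mR => k * x + thead v : mR).
  by exact: measurable_affine.
have -> : (\int[lebesgue_measure]_x f x)%E =
   (k%:E * \int[lebesgue_measure]_x f (k * x + thead v)%R)%E.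
  pose nu0 : {measure set (mR) -> \bar R} :=
    measure_function_pushforward__canonical__measure_function_Measure lebesgue_measure mh.
  transitivity (\int[mscale (NngNum (ltW k0)) nu0]_x f x)%E.
    apply: eq_measure_integral => B mB _.
    exact: (lebesgue_measure_affine (thead v) k0 mB).
  rewrite ge0_integral_mscale//.
  congr (_ * _)%E.
  by rewrite /nu0 /= ge0_integral_pushforward.
have kn0 : k ^+ n != 0 by rewrite expf_neq0// gt_eqF.
rewrite exprS EFinM -muleA; congr (_ * _)%E.
under [in RHS]eq_integral => x _.
  rewrite (_ : lebesgue_tuple _ = ((k ^+ n)^-1%:E * f (k * x + thead v)%R)%E); last first.
    rewrite /f muE (IH v' (xsection A' (k * x + thead v))) ?muleA -?EFinM ?mulVf ?mul1e//.
    exact: measurable_xsection.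
  over.
rewrite ge0_integralZl//.
- by rewrite muleA -EFinM divff// mul1e.
- exact: (measurableT_comp (f := f) mf mh).
- by rewrite lee_fin invr_ge0 exprn_ge0// ltW.
Qed.

(** The iterated product computes the measure of cubes directly; comparison with them shows that
    balls have finite volume and that the unit ball has positive volume. *)
Definition tuple_cube n (r : R) : set (n.-tuple R) :=
  [set t | forall i, `|tnth t i| <= r].

Lemma measurable_tuple_cube n (r : R) : measurable (@tuple_cube n r).
Proof.
rewrite (_ : tuple_cube _ = \bigcap_(i in [set: 'I_n])
    ((fun t => tnth t i) @^-1` [set` `[-r, r]])); last first.
  by apply/seteqP; split => t /= h i => [_|];
    have := h i; rewrite /= in_itv/= ler_norml //; apply.
apply: fin_bigcap_measurable => // i _.
rewrite -[X in measurable X]setTI; apply: (@measurable_tnth _ R n i) => //.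
Qed.

Lemma lebesgue_tuple_cube n (r : R) : 0 < r ->
  lebesgue_tuple (@tuple_cube n r) = ((2 * r) ^+ n)%:E.
Proof.
move=> r0; elim: n => [|n IH].
  by rewrite /= diracE mem_set// => -[].
have [mu muE] := lebesgue_tuple_sigma_finite_measure n.
transitivity ((@lebesgue_measure R \x mu)%E ([set` `[-r, r]] `*` @tuple_cube n r)).
  rewrite /= /product_measure1; apply: eq_integral => x _ /=; rewrite muE; congr lebesgue_tuple.
  apply/seteqP; split => t; rewrite /xsection/= !in_setE/=.
    move=> h; split => [|i].
      by have := h ord0; rewrite /= in_itv /= -ler_norml.
    by have := h (lift ord0 i); rewrite tnthS.
  rewrite in_itv /= -ler_norml => -[hx ht] i.
  by case: (unliftP ord0 i) => [j|] ->; rewrite ?tnthS.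
rewrite product_measure1E//; last exact: measurable_tuple_cube.
rewrite -[X in (X * _)%E]/(lebesgue_measure [set` `[-r, r]]) muE IH.
rewrite lebesgue_measure_itv/= lte_fin gtrN// -EFinB opprK -EFinM exprS.
by congr (_ * _)%:E; ring.
Qed.

End lebesgue_tuple_measure.

(** * Lebesgue measure on an inner product space *)

Section inner_product.
Context {R : realType} {V : normedVectType R} (dot : {dot V for idfun}).
Hypothesis hdot : inner_norm dot.
Implicit Types (x y z e : V) (k : R).

Lemma dotC x y : dot x y = dot y x.
Proof. by rewrite (hermC dot) expr0 mul1r. Qed.

Lemma dotDl x y z : dot (x + y) z = dot x z + dot y z.
Proof. exact: linearDl. Qed.

Lemma dotDr x y z : dot x (y + z) = dot x y + dot x z.
Proof. exact: linearDr. Qed.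

Lemma dotBl x y z : dot (x - y) z = dot x z - dot y z.
Proof. exact: linearBl. Qed.

Lemma dotBr x y z : dot x (y - z) = dot x y - dot x z.
Proof. exact: linearBr. Qed.

Lemma dotNr x y : dot x (- y) = - dot x y.
Proof. exact: linearNr. Qed.

Lemma dotNl x y : dot (- x) y = - dot x y.
Proof. exact: linearNl. Qed.

Lemma dotZr k x y : dot x (k *: y) = k * dot x y.
Proof. exact: linearZr_LR. Qed.

Lemma dotZl k x y : dot (k *: x) y = k * dot x y.
Proof. exact: linearZl_LR. Qed.

Lemma dot0r x : dot x 0 = 0.
Proof. exact: linear0r. Qed.

Lemma dot0l x : dot 0 x = 0.
Proof. exact: linear0l. Qed.

Lemma dot_sumr x (I : Type) (r : seq I) (P : pred I) (F : I -> V) :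
  dot x (\sum_(i <- r | P i) F i) = \sum_(i <- r | P i) dot x (F i).
Proof. exact: linear_sumr. Qed.

Lemma dot_gt0 x : x != 0 -> 0 < dot x x.
Proof. exact: neq0_dnorm_gt0. Qed.

Lemma dot_ge0 x : 0 <= dot x x.
Proof. by have [->|/dot_gt0/ltW//] := eqVneq x 0; rewrite dot0l. Qed.

Lemma dot_norm x : dot x x = `|x| ^+ 2.
Proof. by rewrite hdot sqr_sqrtr// dot_ge0. Qed.

Lemma cauchy_schwarz x y : `|dot x y| <= `|x| * `|y|.
Proof.
have [->|y0] := eqVneq y 0; first by rewrite dot0r normr0 normr0 mulr0.
rewrite -ler_sqr ?nnegrE ?mulr_ge0//.
rewrite -normrX ger0_norm ?sqr_ge0// exprMn -!dot_norm.
(* The component of [x] orthogonal to [y], multiplied by [dot y y] to avoid a division. *)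
have := dot_ge0 (dot y y *: x - dot x y *: y).
rewrite dotBl !dotBr !dotZl !dotZr (dotC y x).
rewrite (_ : _ - _ = dot y y * (dot x x * dot y y - dot x y ^+ 2)); last by ring.
by rewrite pmulr_rge0 ?dot_gt0// subr_ge0.
Qed.

Lemma continuous_dot e : continuous (dot e).
Proof.
move=> x; apply/cvgrPdist_le => eps eps0.
near=> y; rewrite -dotBr (le_trans (cauchy_schwarz _ _))//.
rewrite (@le_trans _ _ ((`|e| + 1) * `|x - y|))//.
  by rewrite ler_wpM2r// lerDl.
rewrite mulrC -ler_pdivlMr; last by rewrite ltr_wpDl.
near: y; apply: cvgr_dist_le; first exact: cvg_id.
by rewrite divr_gt0// ltr_wpDl.
Unshelve. all: by end_near. Qed.

(** Finitely many hyperplanes do not cover the space: a vector good for [vs] is moved along [v], and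
    each [w] rules out at most one coefficient. *)
Lemma exists_nonorthogonal (vs : seq V) : all (fun v => v != 0) vs ->
  exists d, all (fun v => dot v d != 0) vs.
Proof.
elim: vs => [|v vs IH]; first by exists 0.
move=> /andP[v0 /IH[d dP]].
(* A [w] orthogonal to [v] contributes the default quotient [0], which merely excludes one more
   coefficient; such a [w] is treated separately below. *)
pose bad : seq R := [seq - dot w d / dot w v | w <- v :: vs].
have [k kbad] : exists k : R, k \notin bad.
  (* This number exceeds the absolute value of every element of [bad]. *)
  exists (\sum_(r <- bad) `|r| + 1); apply/negP => kin.
  have : \sum_(r <- bad) `|r| + 1 <= \sum_(r <- bad) `|r|.
    rewrite {2}(perm_big _ (perm_to_rem kin)) big_cons.
    by rewrite (le_trans (ler_norm _))// lerDl sumr_ge0.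
  by rewrite gerDl ler10.
exists (d + k *: v); apply/allP => w win.
rewrite dotDr dotZr; apply/negP => /eqP h0.
have [wv0|wv0] := eqVneq (dot w v) 0.
  move: h0; rewrite wv0 mulr0 addr0 => wd0.
  move: win; rewrite inE => /predU1P[wv|win].
    by move: (dot_gt0 v0); rewrite -{1}wv wv0 ltxx.
  by move/allP: dP => /(_ _ win)/=; rewrite wd0 eqxx.
case/negP: kbad; apply/mapP; exists w => //.
by apply: (mulIf wv0); rewrite divfK//; apply/eqP; rewrite -subr_eq0 opprK addrC h0.
Qed.

Variables (b : (\dim {:V}).-tuple V) (hb : orthonormal dot b).
Local Notation n := (\dim {:V}).

Lemma dot_onb i j : dot (tnth b i) (tnth b j) = (i == j)%:R.
Proof.
have /andP[/allP b1 borth] := hb.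
have [<-|ij] := eqVneq i j.
  by apply/eqP; apply: (b1 _ (mem_tnth i b)).
have H s : pair_ortho_rec dot s ->
    forall k l : nat, (k < l < size s)%N -> dot s`_k s`_l = 0.
  elim: s => [|v s IH] /=; first by move=> _ k l; rewrite ltn0 andbF.
  rewrite /ortho_rec /= andbT => /andP[/allP vs /IH {}IH] [|k] [|l]//=.
    by move=> ls; apply/eqP; apply: vs; apply: mem_nth.
  exact: IH.
have nthE (k : 'I_(\dim {:V})) : tnth b k = b`_k by exact: tnth_nth.
rewrite !nthE.
move: ij; rewrite -val_eqE neq_ltn => /orP[ij|ij].
  by apply: H => //; rewrite ij size_tuple ltn_ord.
by rewrite dotC; apply: H => //; rewrite ij size_tuple ltn_ord.
Qed.

Lemma onb_basis : basis_of fullv b.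
Proof.
rewrite basisEfree subvf size_tuple leqnn !andbT.
apply/freeP => c c0 i.
have := dot0r (tnth b i); rewrite -c0 dot_sumr (bigD1 i)//= big1 ?addr0.
  by rewrite -tnth_nth dotZr dot_onb eqxx mulr1.
by move=> j ji; rewrite -tnth_nth dotZr dot_onb eq_sym (negPf ji) mulr0.
Qed.

Lemma onb_expand x : x = \sum_(i < n) dot x (tnth b i) *: tnth b i.
Proof.
have xE := coord_basis onb_basis (memvf x).
rewrite {1}xE; apply: eq_bigr => i _; rewrite -tnth_nth; congr (_ *: _).
rewrite [in RHS]xE dotC dot_sumr (bigD1 i)//= big1 ?addr0.
  by rewrite -tnth_nth dotZr dot_onb eqxx mulr1.
by move=> j ji; rewrite -tnth_nth dotZr dot_onb eq_sym (negPf ji) mulr0.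
Qed.

Lemma dot_expand x y :
  dot x y = \sum_(i < n) dot x (tnth b i) * dot y (tnth b i).
Proof.
rewrite {1}(onb_expand y) dot_sumr; apply: eq_bigr => i _.
by rewrite dotZr mulrC.
Qed.

Definition of_coords (t : n.-tuple R) : V := \sum_(i < n) tnth t i *: tnth b i.

Definition to_coords (x : V) : n.-tuple R := [tuple dot x (tnth b i) | i < n].

Lemma of_coordsK : cancel of_coords to_coords.
Proof.
move=> t; apply: eq_from_tnth => i; rewrite tnth_mktuple dotC dot_sumr.
rewrite (bigD1 i)//= big1 ?addr0; first by rewrite dotZr dot_onb eqxx mulr1.
by move=> j ji; rewrite dotZr dot_onb eq_sym (negPf ji) mulr0.
Qed.

Lemma to_coordsK : cancel to_coords of_coords.
Proof.
move=> x; rewrite [RHS]onb_expand; apply: eq_bigr => i _.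
by rewrite tnth_mktuple.
Qed.

Lemma of_coords_affine k (v t : n.-tuple R) :
  of_coords (tuple_affine k v t) = k *: of_coords t + of_coords v.
Proof.
rewrite /of_coords scaler_sumr -big_split; apply: eq_bigr => i _ /=.
by rewrite tnth_mktuple scalerA -scalerDl.
Qed.

End inner_product.

Section measure_on_V.
Context {R : realType} {V : normedVectType R}.
Local Notation n := (\dim {:V}).

(* [V] with the sigma-algebra transported along the coordinates in [b]. *)
Definition measV (b : n.-tuple V) : Type := V.

HB.instance Definition _ b := Pointed.copy (measV b) V.

Section sigma_algebra.
Variable b : n.-tuple V.

Let measurableV : set (set (measV b)) :=
  [set A | measurable (of_coords b @^-1` A)].

Let measurableV0 : measurableV set0.
Proof. by rewrite /measurableV /= preimage_set0. Qed.

Let measurableVC A : measurableV A -> measurableV (~` A).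
Proof. by rewrite /measurableV /= preimage_setC; exact: measurableC. Qed.

Let measurableV_bigcup (F : (set (measV b))^nat) :
  (forall i, measurableV (F i)) -> measurableV (\bigcup_i (F i)).
Proof.
by move=> mF; rewrite /measurableV /= preimage_bigcup; exact: bigcupT_measurable.
Qed.

HB.instance Definition _ := @isMeasurable.Build default_measure_display
  (measV b) measurableV measurableV0 measurableVC measurableV_bigcup.

Lemma measurable_of_coords :
  measurable_fun [set: n.-tuple R] (of_coords b : n.-tuple R -> measV b).
Proof. by move=> _ A mA; rewrite setTI. Qed.

Variables (dot : {dot V for idfun}) (hdot : inner_norm dot).
Hypothesis hb : orthonormal dot b.

Lemma measurable_into_V d (T : measurableType d) (g : T -> measV b) :
  (forall i, measurable_fun [set: T] (fun t => dot (g t) (tnth b i))) ->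
  measurable_fun [set: T] g.
Proof.
move=> mg.
have -> : g = (of_coords b : n.-tuple R -> measV b) \o (fun t => to_coords dot b (g t)).
  by apply/funext => t /=; rewrite (to_coordsK hb).
apply: measurableT_comp; first exact: measurable_of_coords.
apply/measurable_fun_tnthP => i.
rewrite (_ : _ \o _ = fun t => dot (g t) (tnth b i)); first exact: mg.
by apply/funext => t /=; rewrite tnth_mktuple.
Qed.

Lemma measurable_from_V d (T : measurableType d) (f : measV b -> T) :
  measurable_fun setT (f \o of_coords b) -> measurable_fun [set: measV b] f.
Proof.
move=> mf _ A mA; rewrite setTI.
suff : measurable (of_coords b @^-1` (f @^-1` A)) by [].
by rewrite -comp_preimage -[X in measurable X]setTI; exact: mf.
Qed.

Lemma measurable_dot (e : V) : measurable_fun [set: measV b] (dot e : measV b -> R).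
Proof.
apply: measurable_from_V.
rewrite (_ : _ \o _ = fun t => \sum_(i < n) tnth t i * dot e (tnth b i)).
  apply: measurable_sum => i; apply: measurable_funM => //.
  exact: measurable_tnth.
apply/funext => t /=; rewrite dot_sumr; apply: eq_bigr => i _.
by rewrite dotZr.
Qed.

Lemma measurable_dotl (e : V) : measurable_fun [set: measV b] (fun x : measV b => dot x e).
Proof.
rewrite (_ : (fun x : measV b => dot x e) = (dot e : measV b -> R)).
  exact: measurable_dot.
by apply/funext => x; rewrite dotC.
Qed.

Lemma measurable_norm : measurable_fun [set: measV b] (fun x : measV b => `|x : V|).
Proof.
rewrite (_ : (fun x : measV b => `|x : V|) =
    fun x : measV b => Num.sqrt (\sum_(i < n) dot x (tnth b i) ^+ 2)).
  apply: measurableT_comp => //.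
    apply: continuous_measurable_fun; exact: sqrt_continuous.
  by apply: measurable_sum => i; apply: measurable_funX; exact: measurable_dotl.
by apply/funext => x; rewrite hdot (dot_expand hb).
Qed.

Lemma measurable_add d (T : measurableType d) (f g : T -> measV b) :
  measurable_fun [set: T] f -> measurable_fun [set: T] g ->
  measurable_fun [set: T] (fun t => (f t : V) + g t : measV b).
Proof.
move=> mf mg; apply: measurable_into_V => i.
under eq_fun do rewrite dotDl.
by apply: measurable_funD; apply: (measurableT_comp (measurable_dotl _)).
Qed.

Lemma measurable_scale k d (T : measurableType d) (f : T -> measV b) :
  measurable_fun [set: T] f ->
  measurable_fun [set: T] (fun t => k *: (f t : V) : measV b).
Proof.
move=> mf; apply: measurable_into_V => i.
under eq_fun do rewrite dotZl.
by apply: measurable_funM => //; apply: (measurableT_comp (measurable_dotl _)).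
Qed.

Lemma measurable_cball a r : measurable (cball a r : set (measV b)).
Proof.
rewrite (_ : cball a r = (fun x : measV b => `|(x : V) + - a| <= r) @^-1` [set true]).
  rewrite -[X in measurable X]setTI.
  apply: measurable_fun_ler => //.
  by apply: (measurableT_comp measurable_norm); apply: measurable_add => //.
by apply/seteqP; split => x.
Qed.

Lemma Vol_sigma_finite_measure :
  exists mu : {sigma_finite_measure set (measV b) -> \bar R},
    forall A, mu A = Vol b A.
Proof.
have [mu muE] := @lebesgue_tuple_sigma_finite_measure R n.
have mto : measurable_fun [set: measV b] (to_coords dot b : measV b -> n.-tuple R).
  apply/measurable_fun_tnthP => i.
  rewrite (_ : _ \o _ = fun x : measV b => dot x (tnth b i)).
    exact: measurable_dotl.
  by apply/funext => t /=; rewrite tnth_mktuple.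
have [nu nuE] := sigma_finite_pushforward (sigma_finiteT mu)
  measurable_of_coords mto (of_coordsK hb).
by exists nu => A; rewrite nuE; exact: muE.
Qed.

Lemma Vol_affine (k : R) (v : V) (A : set (measV b)) : 0 < k -> measurable A ->
  Vol b A = ((k ^+ n)%:E * Vol b [set x | A (k *: x + v)%R])%E.
Proof.
move=> k0 mA; rewrite /Vol (@lebesgue_tuple_affine _ _ k (to_coords dot b v))//.
congr (_ * lebesgue_tuple _)%E; apply/seteqP; split => t /=;
by rewrite -!/(of_coords _ _) of_coords_affine (to_coordsK hb).
Qed.

Lemma Vol_cball_fin (r : R) : (Vol b (cball 0%R r) < +oo)%E.
Proof.
have [mu muE] := Vol_sigma_finite_measure.
(* Coordinates are bounded by the norm, so this cube contains the ball; the [+ 1] keeps its side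
   positive. *)
pose C := of_coords b @` (@tuple_cube R n (`|r| + 1)).
have CE : of_coords b @^-1` C = @tuple_cube R n (`|r| + 1).
  apply/seteqP; split => t /=; last by move=> ?; exists t.
  by move=> [u uC] /(can_inj (of_coordsK hb)) <-.
have mC : measurable (C : set (measV b)).
  by rewrite /measurable /= /measurableV /= CE; exact: measurable_tuple_cube.
rewrite -muE (@le_lt_trans _ _ (mu C))//.
  rewrite le_measure ?inE//; first exact: measurable_cball.
  move=> x; rewrite /cball /= subr0 => xr; exists (to_coords dot b x);
    last exact: (to_coordsK hb).
  move=> i; rewrite tnth_mktuple (le_trans (cauchy_schwarz hdot _ _))//.
  rewrite (_ : `|tnth b i| = 1) ?mulr1; last by rewrite hdot (dot_onb hb) eqxx sqrtr1.
  by rewrite (le_trans xr)// (le_trans (ler_norm _))// lerDl.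
rewrite muE /Vol (_ : [set _ | _] = of_coords b @^-1` C)// CE lebesgue_tuple_cube ?ltry//.
Qed.

Lemma Vol_cball_gt0 : (0 < Vol b (cball 0%R 1%R))%E.
Proof.
have [mu muE] := Vol_sigma_finite_measure.
(* By the triangle inequality a cube of half-side at most [1 / n] lies in the unit ball; [n.+1]
   keeps [r] positive in dimension 0 too. *)
pose r : R := (n.+1%:R)^-1.
pose C := of_coords b @` (@tuple_cube R n r).
have CE : of_coords b @^-1` C = @tuple_cube R n r.
  apply/seteqP; split => t /=; last by move=> ?; exists t.
  by move=> [u uC] /(can_inj (of_coordsK hb)) <-.
have mC : measurable (C : set (measV b)).
  by rewrite /measurable /= /measurableV /= CE; exact: measurable_tuple_cube.
rewrite -muE (@lt_le_trans _ _ (mu C))//.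
  rewrite muE /Vol (_ : [set _ | _] = of_coords b @^-1` C)// CE lebesgue_tuple_cube.
    by rewrite lte_fin exprn_gt0// mulr_gt0// invr_gt0.
  by rewrite invr_gt0.
rewrite le_measure ?inE//; first exact: measurable_cball.
move=> _ [t tr <-]; rewrite /cball /= subr0 (le_trans (ler_norm_sum _ _ _))//.
apply: (@le_trans _ _ (\sum_(i < n) r)).
  apply: ler_sum => i _; rewrite normrZ.
  by rewrite (_ : `|tnth b i| = 1) ?mulr1// hdot (dot_onb hb) eqxx sqrtr1.
rewrite sumr_const card_ord -mulr_natl /r ler_pdivrMr// mul1r ler_nat.
exact: leqnSn.
Qed.

End sigma_algebra.
End measure_on_V.

(** * Invariance of volume under translations and linear isometries *)

Section isometry_invariance.
Context {R : realType} {V : normedVectType R} (dot : {dot V for idfun}).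
Hypothesis hdot : inner_norm dot.
Variable b : (\dim {:V}).-tuple V.
Hypothesis hb : orthonormal dot b.
Local Notation mV := (measV b).
Implicit Types A B : set mV.

Let measurable_V2 (f : mV * mV -> mV) A : measurable_fun setT f -> measurable A ->
  measurable (f @^-1` A).
Proof. by move=> mf mA; rewrite -[X in measurable X]setTI; exact: mf. Qed.

(* Fubini for the indicator of [{(x, y) | A x /\ B (y - x)}], translating [x] by
   [y] and then [y] by [x]. For a symmetric [B] of finite positive measure it
   shows that translation-invariant measures are proportional. *)
Lemma translation_invariant_symmetry
    (mu nu : {sigma_finite_measure set mV -> \bar R}) A B :
  (forall v A, measurable A -> mu [set x | A ((x : V) + v)] = mu A) ->
  (forall v A, measurable A -> nu [set x | A ((x : V) + v)] = nu A) ->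
  measurable A -> measurable B ->
  (mu A * nu B = mu [set x | B (- (x : V))%R] * nu A)%E.
Proof.
move=> tmu tnu mA mB.
have mopp d (T : measurableType d) (f : T -> mV) : measurable_fun setT f ->
    measurable_fun setT (fun t => - (f t : V) : mV).
  move=> mf; under eq_fun do rewrite -scaleN1r.
  exact: (measurable_scale hb).
pose S : set (mV * mV) := [set p | A p.1 /\ B ((p.2 : V) - p.1)].
pose S' : set (mV * mV) := [set p | A ((p.1 : V) + p.2) /\ B (- (p.1 : V))].
have mS : measurable S.
  apply: measurableI; first exact: (measurable_V2 measurable_fst).
  apply: (measurable_V2 (f := fun p => (p.2 : V) - p.1)) => //.
  by apply: (measurable_add hb) => //; exact: mopp.
have mS' : measurable S'.
  apply: measurableI.
    apply: (measurable_V2 (f := fun p => (p.1 : V) + p.2)) => //.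
    exact: (measurable_add hb).
  apply: (measurable_V2 (f := fun p => - (p.1 : V))) => //.
  exact: mopp.
have swap (Z : set (mV * mV)) : measurable Z ->
    (\int[mu]_x nu (xsection Z x) = \int[nu]_y mu (ysection Z y))%E.
  move=> mZ.
  have := @indic_fubini_tonelli _ _ _ _ _ mu nu _ mZ.
  by rewrite indic_fubini_tonelli_FE// indic_fubini_tonelli_GE.
have mNB : measurable ([set x | B (- (x : V))] : set mV).
  rewrite -[X in measurable X]setTI.
  by apply: (mopp _ _ id) => //; exact: measurable_id.
transitivity (\int[mu]_x nu (xsection S x))%E.
  transitivity (\int[mu]_x (nu B * (\1_A x)%:E))%E.
    rewrite ge0_integralZl//; last exact/measurable_EFinP/measurable_indic.
    by rewrite integral_indic// setIT muleC.
  apply: eq_integral => x _; rewrite indicE.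
  have [xA|xA] := boolP (x \in A).
    rewrite mule1 -(tnu (- (x : V)) B mB); congr (nu _).
    apply/seteqP; split => y; rewrite /xsection /S /= in_setE/=; last by case.
    by split => //; exact: set_mem.
  rewrite mule0 (_ : xsection _ _ = set0) ?measure0//.
  apply/seteqP; split => y //; rewrite /xsection /S /= in_setE/= => -[Ax].
  by rewrite mem_set in xA.
rewrite swap//.
transitivity (\int[nu]_y mu (ysection S' y))%E.
  apply: eq_integral => y _; rewrite -(tmu y); last exact: measurable_ysection.
  congr (mu _); apply/seteqP; split => x; rewrite /ysection /S /S' /= !in_setE/=;
  by rewrite opprD addrCA subrr addr0.
rewrite -swap//.
transitivity (\int[mu]_x (nu A * (\1_[set x | B (- (x : V))%R] x)%:E))%E.
  apply: eq_integral => x _; rewrite indicE.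
  have [/set_mem /= xB|xB] := boolP (x \in _).
    rewrite mule1 -(tnu x A mA); congr (nu _).
    apply/seteqP; split => y; rewrite /xsection /S' /= in_setE/= addrC; first by case.
    by [].
  rewrite mule0 (_ : xsection _ _ = set0) ?measure0//.
  apply/seteqP; split => y //; rewrite /xsection /S' /= in_setE/= => -[_ Bx].
  by move: xB; rewrite mem_set.
rewrite ge0_integralZl//; last exact/measurable_EFinP/measurable_indic.
by rewrite integral_indic// setIT muleC.
Qed.

Lemma Vol_translation v A : measurable A -> Vol b [set x | A (x + v)] = Vol b A.
Proof.
move=> mA; rewrite (Vol_affine hb v (@ltr01 R) mA) expr1n mul1e.
by congr (Vol b _); apply/seteqP; split => x /=; rewrite scale1r.
Qed.

Lemma measurable_linear_isometry (s : V -> V) :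
  (forall x y, dot (s x) (s y) = dot x y) -> involutive s ->
  measurable_fun [set: mV] (s : mV -> mV).
Proof.
move=> sdot sK; apply: (measurable_into_V hb) => i.
rewrite (_ : (fun t => _) = fun x : mV => dot x (s (tnth b i))).
  exact: measurable_dotl.
by apply/funext => x; rewrite -[in LHS](sK (tnth b i)) sdot.
Qed.

(** The pushforward of volume along [s] is again translation invariant, hence proportional to
    volume. The factor is 1 because [s] preserves the unit ball, whose volume is finite and
    positive. An involution is its own inverse in the pushforward; this covers the reflections and
    [-%R]. *)
Lemma Vol_isometry (s : V -> V) A : {morph s : x y / x + y} ->
  (forall x y, dot (s x) (s y) = dot x y) -> involutive s ->
  measurable A -> Vol b (s @^-1` A) = Vol b A.
Proof.
move=> sD sdot sK mA.
have [mu muE] := Vol_sigma_finite_measure hb.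
have ms := measurable_linear_isometry sdot sK.
have [nu nuE] := sigma_finite_pushforward (sigma_finiteT mu) ms ms sK.
have tmu v (C : set mV) : measurable C -> mu [set x | C ((x : V) + v)] = mu C.
  by move=> mC; rewrite !muE Vol_translation.
have nuV C : nu C = Vol b (s @^-1` C) by rewrite nuE; exact: muE.
have tnu v (C : set mV) : measurable C -> nu [set x | C ((x : V) + v)] = nu C.
  (* A translation by [v] after [s] is a translation by [s v] before it. *)
  move=> mC; rewrite !nuV -(Vol_translation (s v) (A := s @^-1` C)).
    by congr (Vol b _); apply/seteqP; split => x /=; rewrite sD sK.
  by rewrite -[X in measurable X]setTI; exact: ms.
have mB := measurable_cball hdot hb 0 1.
have := translation_invariant_symmetry tmu tnu mA mB.
have -> : [set x | cball 0 1 (- x : V)] = cball (0 : V) 1.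
  by apply/seteqP; split => x; rewrite /cball /= !subr0 normrN.
rewrite !nuV.
have -> : s @^-1` cball 0 1 = cball (0 : V) 1.
  by apply/seteqP; split => x; rewrite /cball /= !subr0 (hdot (s x)) sdot -hdot.
rewrite !muE [X in X = _]muleC => /esym/eqP.
have B0 := Vol_cball_gt0 hdot hb; have B1 := Vol_cball_fin hdot hb 1.
have Bfin : Vol b (cball 0%R 1%R) \is a fin_num by rewrite ge0_fin_numE// ltW.
by rewrite eq_le !(lee_pmul2l Bfin B0) -eq_le => /eqP.
Qed.

End isometry_invariance.

(** * Polar coordinates *)

Section polar.
Context {R : realType} {V : normedVectType R} (dot : {dot V for idfun}).
Hypothesis hdot : inner_norm dot.
Variable b : (\dim {:V}).-tuple V.
Hypothesis hb : orthonormal dot b.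
Local Notation mV := (measV b).
Local Notation n := (\dim {:V}).
Variable mu : {sigma_finite_measure set mV -> \bar R}.
Hypothesis muE : forall A, mu A = Vol b A.
Local Notation B := (cball (0 : V) (1 : R) : set mV).

Definition cone (C : set V) := forall (k : R) x, 0 < k -> C (k *: x) <-> C x.

Definition homogeneous0 (T : Type) (f : V -> T) :=
  forall (k : R) x, 0 < k -> f (k *: x) = f x.

Let mB : measurable B := measurable_cball hdot hb 0 1.

(** The case of a radius with countably many values. On the cone where [tau x = j] the set is the
    dilate by [v j] of the part in the unit ball, so its volume gains the factor [v j ^+ n]. *)
Lemma polar_step (C : set mV) (tau : V -> nat) (v : nat -> R) :
  measurable C -> cone C -> homogeneous0 tau ->
  (forall j, 0 < v j) -> (forall j, measurable ([set x | tau x = j] : set mV)) ->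
  mu [set x | C x /\ `|x : V| <= v (tau x)] =
  (\int[mu]_(x in C `&` B) ((v (tau x)) ^+ n)%:E)%E.
Proof.
move=> mC cC htau v0 mtau.
pose D j : set mV := C `&` [set x | tau x = j].
have mD j : measurable (D j) by exact: measurableI.
have trD (G : nat -> set mV) : trivIset setT (fun j => D j `&` G j).
  apply/trivIsetP => i j _ _ ij; apply/seteqP; split => // x.
  by move=> [[[_ /= xi] _] [[_ /= xj] _]]; move/eqP: ij; apply; rewrite -xi -xj.
have -> : [set x | C x /\ `|x : V| <= v (tau x)] =
    \bigcup_j (D j `&` cball (0 : V) (v j)).
  apply/seteqP; split => [x [Cx xv]|x [j _ [[Cx /= xj]]]].
    by exists (tau x) => //; split => //; rewrite /cball /= subr0.
  by rewrite /cball /= subr0 -xj.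
have -> : C `&` B = \bigcup_j (D j `&` B).
  apply/seteqP; split => [x [Cx Bx]|x [j _ [[Cx _]]]] //.
  by exists (tau x).
have mDc j : measurable (D j `&` cball (0 : V) (v j)).
  by apply: measurableI => //; exact: measurable_cball.
have mDB j : measurable (D j `&` B) by exact: measurableI.
rewrite measure_bigcup//.
rewrite ge0_integral_bigcup//; first last.
- by move=> x _; rewrite lee_fin exprn_ge0// ltW.
- apply/measurable_fun_bigcup => // j.
  apply: (eq_measurable_fun (cst (v j ^+ n)%:E)) => // x.
  by rewrite inE => -[[_ /= ->]].
under eq_eseriesl do rewrite in_setT.
apply: eq_eseriesr => j _.
rewrite (eq_integral (cst (v j ^+ n)%:E)); last first.
  by move=> x; rewrite inE => -[[_ /= ->]].
rewrite integral_cst// -[LHS]/(mu _) -[X in _ = (_ * X)%E]/(mu (D j `&` B)) !muE.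
rewrite (Vol_affine hb 0 (v0 j) (mDc j)); congr (_ * Vol b _)%E.
apply/seteqP; split => x; rewrite /D /cball /= addr0 !subr0 normrZ gtr0_norm//.
  move=> [[/(cC _ _ (v0 j)) Cx]] /=; rewrite htau// => tx.
  by rewrite -[X in _ <= X -> _]mulr1 ler_pM2l.
move=> [[Cx tx] x1]; split; last by rewrite -[X in _ <= X]mulr1 ler_pM2l.
by split; [apply/cC|rewrite /= htau].
Qed.

(* Rounding up keeps the values positive, so that the balls of these radii are
   dilates of the unit ball. *)
Let q (k : nat) (u : R) : R := (Num.truncn (k.+1%:R * u)).+1%:R / k.+1%:R.

Let q_gt k u : u < q k u.
Proof.
rewrite /q ltr_pdivlMr ?ltr0Sn// mulrC.
exact: real_truncnS_gt (num_real _).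
Qed.

Let q_le k u : 0 <= u -> q k u <= u + k.+1%:R^-1.
Proof.
move=> u0; rewrite /q ler_pdivrMr ?ltr0Sn// mulrDl mulVf ?pnatr_eq0//.
by rewrite -natr1 lerD2r mulrC truncn_le mulr_ge0.
Qed.

Let q_gt0 k u : 0 < q k u.
Proof. by rewrite /q divr_gt0. Qed.

Let q_cvg u : 0 <= u -> q k u @[k --> \oo] --> u.
Proof.
move=> u0; apply: (@squeeze_cvgr _ _ _ _ (cst u) (fun k => u + k.+1%:R^-1)).
- by near=> k; rewrite /= (ltW (q_gt _ _)) q_le.
- exact: cvg_cst.
- rewrite -[X in _ --> X]addr0; apply: cvgD; first exact: cvg_cst.
  exact: cvg_harmonic.
Unshelve. all: by end_near. Qed.

Lemma truncn_natr_measurable : measurable_fun [set: R] (fun u : R => (Num.truncn u)%:R : R).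
Proof.
apply: nondecreasing_measurable => // x y xy.
by rewrite ler_nat le_truncn.
Qed.

(** The radius [rho] is replaced by its discretisation [q k (rho x)], to which [polar_step] applies.
    Both sides then pass to the limit by dominated convergence. *)
Lemma polar (C : set mV) (rho : V -> R) (M : R) :
  measurable C -> cone C -> homogeneous0 rho ->
  measurable_fun [set: mV] (rho : mV -> R) -> (forall x, 0 <= rho x <= M) ->
  mu [set x | C x /\ `|x : V| <= rho x] =
  (\int[mu]_(x in C `&` B) ((rho x) ^+ n)%:E)%E.
Proof.
move=> mC cC hrho mrho rhoM.
have rho0 x : 0 <= rho x by have /andP[] := rhoM x.
have qM k x : q k (rho x) <= M + 1.
  rewrite (le_trans (q_le k (rho0 x)))// lerD//; first by have /andP[] := rhoM x.
  by rewrite invf_le1// ler1n.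
have mtr k : measurable_fun [set: mV] (fun x : mV => (Num.truncn (k.+1%:R * rho x))%:R : R).
  apply: (measurableT_comp truncn_natr_measurable).
  exact: measurable_funM.
have mq k : measurable_fun [set: mV] (fun x : mV => q k (rho x)).
  rewrite /q; apply: measurable_funM => //.
  under eq_fun do rewrite -natr1.
  exact: measurable_funD.
have step k : mu [set x | C x /\ `|x : V| <= q k (rho x)] =
    (\int[mu]_(x in C `&` B) ((q k (rho x)) ^+ n)%:E)%E.
  apply: (polar_step (tau := fun x => Num.truncn (k.+1%:R * rho x))
    (v := fun j => j.+1%:R / k.+1%:R)) => //.
  - by move=> c x c0; rewrite hrho.
  - move=> j.
    rewrite (_ : [set x | _] =
      (fun x : mV => (Num.truncn (k.+1%:R * rho x))%:R : R) @^-1` [set j%:R]).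
      by rewrite -[X in measurable X]setTI; exact: mtr.
    apply/seteqP; split => x /=; first by move=> ->.
    by move/eqP; rewrite eqr_nat => /eqP.
have mBM : measurable (cball (0 : V)%R (M + 1)%R : set mV) by exact: measurable_cball.
have fBM : (mu (cball (0 : V)%R (M + 1)%R) < +oo)%E.
  by rewrite muE; exact: (Vol_cball_fin hdot hb).
pose S (f : mV -> R) : set mV := [set x | C x /\ `|x : V| <= f x].
have mset (f : mV -> R) : measurable_fun setT f ->
    measurable (S f).
  move=> mf; suff mE : measurable ([set x | `|x : V| <= f x] : set mV) by exact: measurableI.
  rewrite (_ : [set x | _] = (fun x : mV => `|x : V| <= f x) @^-1` [set true]).
    rewrite -[X in measurable X]setTI.
    by apply: measurable_fun_ler => //; exact: measurable_norm hdot hb.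
  by apply/seteqP; split => x.
(* Writing the measures as integrals of indicators over one fixed ball of finite volume makes the
   constant 1 a dominating function. *)
have muI (f : mV -> R) : measurable_fun setT f -> (forall x, f x <= M + 1) ->
    mu (S f) =
    (\int[mu]_(x in cball (0 : V)%R (M + 1)%R) (\1_(S f) x)%:E)%E.
  move=> mf fM; rewrite integral_indic//; last exact: mset.
  congr (mu _); apply/seteqP; split => [x [Cx xf]|x []//].
  by split => //; rewrite /cball /= subr0 (le_trans xf).
have Mk x : rho x <= M + 1.
  by have /andP[_ h] := rhoM x; rewrite (le_trans h)// lerDl.
have M0 : 0 <= M + 1 := le_trans (rho0 0) (Mk 0).
have lhs : (mu (S (fun x => q k (rho x))) @[k --> \oo] -->
    mu (S rho))%E.
  under eq_cvg => k do rewrite (muI _ (mq k) (qM k)).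
  rewrite (muI _ mrho Mk).
  apply: (@dominated_cvg _ _ _ mu _ mBM _ _ (cst 1%E)) => //.
  - by move=> k; apply/measurable_EFinP; apply: measurable_indic; exact: mset.
  - move=> x _; apply: cvg_EFin; first by near=> k.
    apply: cvg_near_cst; rewrite /indic /=.
    (* Approximation from above matters on the boundary: a point with [|x| = rho x] stays in every
       approximating set. A point beyond [rho x] leaves them eventually. *)
    have [xrho|rhox] := leP `|x : V| (rho x).
      near=> k; congr (nat_of_bool _)%:R; apply/idP/idP; rewrite !inE /= => -[Cx _]; split => //.
      by rewrite (le_trans xrho)// ltW// q_gt.
    have : \forall k \near \oo, q k (rho x) < `|x : V|.
      exact: (cvgr_lt _ (q_cvg (rho0 x)) _ rhox).
    apply: filterS => k kx; congr (nat_of_bool _)%:R; apply/idP/idP; rewrite !inE /= => -[Cx].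
      by rewrite leNgt kx.
    by rewrite leNgt rhox.
  - apply: (@measurable_bounded_integrable _ _ _ mu (cst 1)) => //.
    by exists 1; split => // t t1 x _ /=; rewrite normr1; exact: ltW.
  - move=> k x _; rewrite /indic /= lee_fin.
    by case: (_ \in _); rewrite ?normr1 ?normr0 ?ler01.
have mCB : measurable (C `&` B) by exact: measurableI.
have rhs : (\int[mu]_(x in C `&` B) ((q k (rho x)) ^+ n)%:E @[k --> \oo] -->
    \int[mu]_(x in C `&` B) ((rho x) ^+ n)%:E)%E.
  apply: (@dominated_cvg _ _ _ mu _ mCB _ _ (cst ((M + 1) ^+ n)%:E)) => //.
  - move=> k; apply/measurable_EFinP; apply: measurable_funX.
    exact: measurable_funTS.
  - move=> x _; apply: cvg_EFin; first by near=> k.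
    exact: (cvg_comp _ _ (q_cvg (rho0 x)) (@exprn_continuous _ n _)).
  - apply: (@measurable_bounded_integrable _ _ _ mu (cst ((M + 1) ^+ n))) => //.
      rewrite (@le_lt_trans _ _ (mu B))//; first by rewrite le_measure ?inE//; apply: subIsetr.
      by rewrite muE; exact: (Vol_cball_fin hdot hb).
    by exists `|(M + 1) ^+ n|; split => // t t1 x _; exact: ltW.
  - move=> k x _; have q0 := ltW (q_gt0 k (rho x)).
    by rewrite /= lee_fin ger0_norm ?exprn_ge0// lerXn2r.
move: lhs; under eq_cvg => k do rewrite [mu _]step.
by move=> lhs; exact: (cvg_unique _ lhs rhs).
Unshelve. all: by end_near. Qed.

End polar.

(** * Moments of an antisymmetric function *)

(** Inversion is continuous away from 0, and the remaining piece is a single point. *)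
Lemma measurable_inv {R : realType} : measurable_fun [set: R] (@GRing.inv R).
Proof.
have -> : [set: R] = [set u : R | u != 0] `|` [set 0].
  by apply/seteqP; split => u //= _; have [->|] := eqVneq u 0; [right|left].
have m0 : measurable [set u : R | u != 0].
  rewrite (_ : [set u | _] = ~` [set 0]); first exact: measurableC.
  by apply/seteqP; split => u /= /eqP.
apply/measurable_funU => //; split; last exact: measurable_fun_set1.
apply: open_continuous_measurable_fun; first exact: open_neq.
by move=> u; rewrite inE /= => u0; exact: inv_continuous.
Qed.

(** * Integrals of bounded functions over the unit ball *)

Section ball_integral.
Context {R : realType} {V : normedVectType R} (dot : {dot V for idfun}).
Hypothesis hdot : inner_norm dot.
Variable b : (\dim {:V}).-tuple V.
Hypothesis hb : orthonormal dot b.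
Local Notation mV := (measV b).
Variable mu : {sigma_finite_measure set mV -> \bar R}.
Hypothesis muE : forall A, mu A = Vol b A.
Local Notation B := (cball (0 : V) (1 : R) : set mV).
Implicit Types f g : V -> R.

(** This class is closed under sums, products and polynomials, and its members are integrable on the
    unit ball; it discharges the integrability side conditions throughout. *)
Definition bounded_measurable f :=
  measurable_fun [set: mV] (f : mV -> R) /\ exists M, forall x, `|f x| <= M.

Lemma bm_cst (c : R) : bounded_measurable (fun=> c).
Proof. by split => //; exists `|c|. Qed.

Lemma bm_add f g : bounded_measurable f -> bounded_measurable g ->
  bounded_measurable (fun x => f x + g x).
Proof.
move=> [mf [M fM]] [mg [N gN]]; split; first exact: measurable_funD.
by exists (M + N) => x; rewrite (le_trans (ler_normD _ _))// lerD.
Qed.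

Lemma bm_mul f g : bounded_measurable f -> bounded_measurable g ->
  bounded_measurable (fun x => f x * g x).
Proof.
move=> [mf [M fM]] [mg [N gN]]; split; first exact: measurable_funM.
by exists (M * N) => x; rewrite normrM ler_pM.
Qed.

Lemma bm_exp f k : bounded_measurable f -> bounded_measurable (fun x => f x ^+ k).
Proof.
move=> bf; elim: k => [|k IH].
  by under eq_fun do rewrite expr0; exact: bm_cst.
by under eq_fun do rewrite exprS; exact: bm_mul.
Qed.

Lemma bm_sum (I : eqType) (r : seq I) (F : I -> V -> R) :
  (forall i, i \in r -> bounded_measurable (F i)) ->
  bounded_measurable (fun x => \sum_(i <- r) F i x).
Proof.
elim: r => [|i r IH] bF.
  by under eq_fun do rewrite big_nil; exact: bm_cst.
under eq_fun do rewrite big_cons; apply: bm_add; first exact/bF/mem_head.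
by apply: IH => j jr; apply: bF; rewrite inE jr orbT.
Qed.

Lemma bm_prod (I : Type) (r : seq I) (F : I -> V -> R) :
  (forall i, bounded_measurable (F i)) ->
  bounded_measurable (fun x => \prod_(i <- r) F i x).
Proof.
move=> bF; elim: r => [|i r IH].
  by under eq_fun do rewrite big_nil; exact: bm_cst.
by under eq_fun do rewrite big_cons; exact: bm_mul.
Qed.

Lemma bm_horner f (p : {poly R}) : bounded_measurable f ->
  bounded_measurable (fun x => p.[f x]).
Proof.
move=> bf; under eq_fun do rewrite horner_coef.
by apply: bm_sum => i _; apply: bm_mul; [exact: bm_cst|exact: bm_exp].
Qed.

Lemma bm_indic (C : set mV) : measurable C -> bounded_measurable (\1_C : V -> R).
Proof.
move=> mC; split; first exact: measurable_indic.
by exists 1 => x; rewrite indicE; case: (_ \in _); rewrite ?normr1 ?normr0 ?ler01.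
Qed.

Definition ballint f : R := \int[mu]_(x in B) f x.

Let mB : measurable B := measurable_cball hdot hb 0 1.

Let Bfin : (mu B < +oo)%E.
Proof. by rewrite muE; exact: (Vol_cball_fin hdot hb). Qed.

Lemma bm_integrable (D : set mV) f : measurable D -> D `<=` B -> bounded_measurable f ->
  mu.-integrable D (EFin \o f).
Proof.
move=> mD DB [mf [M fM]]; apply: measurable_bounded_integrable => //.
- by rewrite (le_lt_trans _ Bfin)// le_measure ?inE.
- exact: measurable_funTS.
- by exists M; split => [|t Mt x _ /=]; [exact: num_real|rewrite (le_trans (fM x))// ltW].
Qed.

Lemma ballintD f g : bounded_measurable f -> bounded_measurable g ->
  ballint (fun x => f x + g x) = ballint f + ballint g.
Proof. by move=> bf bg; rewrite /ballint RintegralD//; exact: bm_integrable. Qed.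

Lemma ballintZ (c : R) f : bounded_measurable f ->
  ballint (fun x => c * f x) = c * ballint f.
Proof. by move=> bf; rewrite /ballint RintegralZl//; exact: bm_integrable. Qed.

Lemma ballint_sum (I : eqType) (r : seq I) (F : I -> V -> R) :
  (forall i, i \in r -> bounded_measurable (F i)) ->
  ballint (fun x => \sum_(i <- r) F i x) = \sum_(i <- r) ballint (F i).
Proof.
elim: r => [|i r IH] bF.
  under eq_fun do rewrite big_nil.
  by rewrite big_nil /ballint Rintegral_cst// mul0r.
have bF' j : j \in r -> bounded_measurable (F j).
  by move=> jr; apply: bF; rewrite inE jr orbT.
under eq_fun do rewrite big_cons.
by rewrite big_cons ballintD ?IH//; [exact/bF/mem_head|exact: bm_sum].
Qed.

Lemma ballint_bound f (M : R) : bounded_measurable f -> (forall x, `|f x| <= M) ->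
  `|ballint f| <= M * fine (mu B).
Proof.
move=> bf fM; have intf := bm_integrable mB (@subset_refl _ _) bf.
rewrite -(Rintegral_cst mu mB M) (le_trans (le_normr_Rintegral mB intf))//.
apply: le_Rintegral => //.
- by apply: (bm_integrable (f := fun x => `|f x|)) => //; split;
    [apply: measurableT_comp => //; case: bf|exists M => x; rewrite normr_id].
- by apply: (bm_integrable (f := fun=> M)) => //; exact: bm_cst.
Qed.

(** Change of variables along [s], which preserves both the volume and the unit ball. *)
Lemma ballint_isometry f (s : V -> V) : {morph s : x y / x + y} ->
  (forall x y, dot (s x) (s y) = dot x y) -> involutive s ->
  bounded_measurable f -> ballint (f \o s) = ballint f.
Proof.
move=> sD sdot sK bf; rewrite /ballint /Rintegral; congr fine.
have ms := measurable_linear_isometry hb sdot sK.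
have sB : s @^-1` B = B.
  by apply/seteqP; split => x; rewrite /cball /= !subr0 (hdot (s x)) sdot -hdot.
have bfs : bounded_measurable (f \o s).
  by case: bf => mf [M fM]; split; [apply: (measurableT_comp mf ms)|exists M => x; exact: fM].
rewrite -[in LHS]sB.
have := @integral_pushforward _ _ _ _ R _ ms mu B (EFin \o f).
move=> <- //.
- apply: eq_measure_integral => A mA _.
  exact: etrans (muE _) (etrans (Vol_isometry hdot hb sD sdot sK mA) (esym (muE _))).
- by case: bf => mf _; apply/measurable_EFinP.
- rewrite sB; exact: bm_integrable.
Qed.

(* Division by zero makes this [0] at the origin, which therefore needs no
   special treatment, even in dimension 0. *)
Definition unit_dot (a x : V) : R := dot a x / `|x|.

Lemma unit_dot_bound a x : `|unit_dot a x| <= `|a|.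
Proof.
rewrite /unit_dot normrM normfV normr_id.
have [->|x0] := eqVneq x 0; first by rewrite normr0 invr0 mulr0.
by rewrite ler_pdivrMr ?normr_gt0// cauchy_schwarz.
Qed.

Lemma unit_dot_homogeneous a : homogeneous0 (unit_dot a).
Proof.
move=> k x k0; rewrite /unit_dot dotZr normrZ gtr0_norm// -mulf_div divff ?mul1r//.
by rewrite gt_eqF.
Qed.

Lemma bm_unit_dot a : bounded_measurable (unit_dot a).
Proof.
split; last by exists `|a| => x; exact: unit_dot_bound.
apply: measurable_funM; first exact: measurable_dot.
exact: (measurableT_comp measurable_inv (measurable_norm hdot hb)).
Qed.

End ball_integral.

Section reflection.
Context {R : realType} {V : normedVectType R} (dot : {dot V for idfun}).
Implicit Types e x y : V.

Lemma reflectionD e : {morph reflection dot e : x y / x + y}.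
Proof.
move=> x y; rewrite /reflection dotDr mulrDr mulrDl scalerDl opprD.
by rewrite addrACA.
Qed.

Lemma reflectionZ e (k : R) x : reflection dot e (k *: x) = k *: reflection dot e x.
Proof.
by rewrite /reflection dotZr scalerBr scalerA mulrCA -!mulrA.
Qed.

Lemma dot_reflection e : e != 0 ->
  forall x y, dot (reflection dot e x) (reflection dot e y) = dot x y.
Proof.
move=> /(dot_gt0 dot) e0 x y; rewrite /reflection dotBl !dotBr !dotZl !dotZr.
by rewrite (dotC dot x e); field; rewrite gt_eqF.
Qed.

Lemma dot_reflectionr e x y :
  dot x (reflection dot e y) = dot (reflection dot e x) y.
Proof.
by rewrite /reflection dotBl dotBr dotZl dotZr (dotC dot x e); ring.
Qed.

Lemma reflectionK e : e != 0 -> involutive (reflection dot e).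
Proof.
move=> /(dot_gt0 dot) e0 x; rewrite /reflection dotBr dotZr.
rewrite -addrA -opprD -scalerDl [X in X *: _](_ : _ = 0) ?scale0r ?subr0//.
by field; rewrite gt_eqF.
Qed.

Lemma reflection_fix e x : dot e x = 0 -> reflection dot e x = x.
Proof. by move=> ex; rewrite /reflection ex mulr0 mul0r scale0r subr0. Qed.

End reflection.

Section antisymmetric_moments.
Context {R : realType} {V : normedVectType R} (dot : {dot V for idfun}).
Hypothesis hdot : inner_norm dot.
Variable b : (\dim {:V}).-tuple V.
Hypothesis hb : orthonormal dot b.
Local Notation mV := (measV b).
Variable mu : {sigma_finite_measure set mV -> \bar R}.
Hypothesis muE : forall A, mu A = Vol b A.
Variable sigma : V -> R.
Hypothesis bsigma : bounded_measurable b sigma.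
Variable E : {fset V}.
Hypothesis hE : is_arrangement E.
Hypothesis sigma_reflection : forall e x, e \in E ->
  sigma (reflection dot e x) = - sigma x.

Let E_neq0 e : e \in E -> e != 0.
Proof. by move=> eE; rewrite -normr_gt0 hE.1. Qed.

Let moment a k := ballint mu (fun x => sigma x * unit_dot dot a x ^+ k).

Let bm_moment a d k l : bounded_measurable b
  (fun x => sigma x * (unit_dot dot a x ^+ k * unit_dot dot d x ^+ l)).
Proof.
by apply: bm_mul => //; apply: bm_mul; apply: bm_exp; exact: bm_unit_dot.
Qed.

(** The reflection in [e] is self-adjoint and fixes [a], so it preserves [unit_dot dot a] while
    changing the sign of [sigma]. The moment therefore equals its own opposite. *)
Lemma moment_on_hyperplane e a k : e \in E -> dot e a = 0 -> moment a k = 0.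
Proof.
move=> eE ea; have e0 := E_neq0 eE.
have bf : bounded_measurable b (fun x => sigma x * unit_dot dot a x ^+ k).
  by apply: bm_mul => //; apply: bm_exp; exact: bm_unit_dot.
have := ballint_isometry hdot hb muE (reflectionD dot e) (dot_reflection dot e0)
  (reflectionK dot e0) bf.
rewrite (_ : _ \o _ = fun x => -1 * (sigma x * unit_dot dot a x ^+ k)).
  rewrite (ballintZ hdot hb muE)// -/(moment a k) mulN1r => /eqP.
  by rewrite eq_sym -addr_eq0 -mulr2n mulrn_eq0 /= => /eqP.
apply/funext => x /=; rewrite sigma_reflection// mulN1r mulNr; congr (- (_ * _ ^+ _)).
rewrite /unit_dot dot_reflectionr reflection_fix//; congr (_ / _).
by rewrite (hdot (reflection _ _ _)) dot_reflection// -hdot.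
Qed.

(* On a generic line through [a] the moment is a polynomial of degree at most
   [k] in the parameter, with a root on each of the [#|E| > k] hyperplanes. *)
Lemma moment_eq0 a k : (k < #|` E|)%N -> moment a k = 0.
Proof.
move=> kE; have [/existsP/=|] := boolP [exists e : E, dot (val e) a == 0].
  by move=> [e /eqP ea]; exact: moment_on_hyperplane ea.
rewrite negb_exists => /forallP/= na.
have {}na e : e \in E -> dot e a != 0 by move=> eE; have := na [` eE]%fset.
(* The direction [d] must be off every hyperplane, so that the line through [a] meets each of them.
   It must also not be orthogonal to any [dot e a *: f - dot f a *: e], so that the parameters of
   the meeting points are distinct. *)
pose vs : seq V := (E : seq V) ++
  [seq dot p.1 a *: p.2 - dot p.2 a *: p.1 | p <- [seq (e, f) | e <- E, f <- E] & p.1 != p.2].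
have vs0 : all (fun v => v != 0) vs.
  rewrite all_cat; apply/andP; split.
    by apply/allP => e eE; exact: E_neq0.
  apply/allP => v /mapP[[e f]]; rewrite mem_filter => /andP[/= ef].
  move=> /allpairsP[[e1 f1] /= [eE fE [ee1 ff1]]] ->; rewrite -ee1 -ff1 in eE fE.
  apply/negP => /eqP /subr0_eq efa.
  have := hE.2 f e fE eE; rewrite eq_sym => /(_ ef).
  rewrite free_cons span_seq1 => /andP[/negP + _]; apply.
  apply/vlineP; exists ((dot e a)^-1 * dot f a).
  by rewrite -scalerA -efa scalerA mulVf ?scale1r ?na.
have [d dP] := exists_nonorthogonal dot vs0.
have dE e : e \in E -> dot e d != 0.
  by move=> eE; have /allP := dP; apply; rewrite mem_cat eE.
have dEE e f : e \in E -> f \in E -> e != f -> dot e a * dot f d != dot f a * dot e d.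
  move=> eE fE ef; have /allP := dP.
  move=> /(_ (dot e a *: f - dot f a *: e)).
  rewrite dotBl !dotZl subr_eq0; apply.
  rewrite mem_cat; apply/orP; right; apply/mapP; exists (e, f) => //.
  by rewrite mem_filter /= ef; apply/allpairsP; exists (e, f).
pose c j := ballint mu
  (fun x => sigma x * (unit_dot dot a x ^+ (k - j) * unit_dot dot d x ^+ j)).
pose p : {poly R} := \poly_(j < k.+1) (c j *+ 'C(k, j)).
have pE t : p.[t] = moment (a + t *: d) k.
  rewrite horner_poly /moment.
  transitivity (ballint mu (fun x => \sum_(j < k.+1) ((t ^+ j *+ 'C(k, j)) *
      (sigma x * (unit_dot dot a x ^+ (k - j) * unit_dot dot d x ^+ j))))).
    rewrite (ballint_sum hdot hb muE); last first.
      by move=> j _; apply: bm_mul; [exact: bm_cst|exact: bm_moment].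
    apply: eq_bigr => j _; rewrite (ballintZ hdot hb muE); last exact: bm_moment.
    by rewrite -/(c j) mulrnAl mulrC mulrnAl mulrC.
  congr ballint; apply/funext => x.
  rewrite /unit_dot dotDl dotZl mulrDl exprDn mulr_sumr; apply: eq_bigr => j _.
  rewrite -mulrA [(t * _) ^+ j]exprMn; ring.
have p_roots : all (root p) [seq - dot e a / dot e d | e <- E].
  apply/allP => _ /mapP[e eE ->]; rewrite /root pE.
  rewrite (moment_on_hyperplane k eE)//.
  by rewrite dotDr dotZr divfK ?dE// subrr.
have p_uniq : uniq [seq - dot e a / dot e d | e <- E].
  rewrite map_inj_in_uniq ?fset_uniq// => e f eE fE /eqP.
  have [//|ef] := eqVneq e f.
  rewrite eqr_div ?dE// !mulNr eqr_opp => h.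
  by have /negP := dEE _ _ eE fE ef.
have p0 : p = 0.
  apply/eqP/negPn/negP => pn0.
  have := max_poly_roots pn0 p_roots p_uniq; rewrite size_map.
  by move=> /leq_trans/(_ (size_poly _ _)); rewrite ltnS leqNgt kE.
have := pE 0; rewrite scale0r addr0 => <-.
by rewrite p0 horner0.
Qed.

Lemma ballint_poly_eq0 a (p : {poly R}) : (size p <= #|` E|)%N ->
  ballint mu (fun x => sigma x * p.[unit_dot dot a x]) = 0.
Proof.
move=> pE.
transitivity (ballint mu (fun x => \sum_(j < size p)
    (p`_j * (sigma x * unit_dot dot a x ^+ j)))).
  congr ballint; apply/funext => x; rewrite horner_coef mulr_sumr.
  by apply: eq_bigr => j _; rewrite mulrCA.
have bm j : bounded_measurable b (fun x => sigma x * unit_dot dot a x ^+ j).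
  by apply: bm_mul => //; apply: bm_exp; exact: bm_unit_dot.
rewrite (ballint_sum hdot hb muE); last first.
  by move=> j _; apply: bm_mul => //; exact: bm_cst.
apply: big1 => j _; rewrite (ballintZ hdot hb muE)// -/(moment a j) moment_eq0 ?mulr0//.
exact: leq_trans (ltn_ord j) pE.
Qed.

End antisymmetric_moments.

(** * Signs and chambers *)

Section sign_function.
Context {R : realType} {V : normedVectType R} (dot : {dot V for idfun}).
Hypothesis hdot : inner_norm dot.
Variable E : {fset V}.
Implicit Types e f x y : V.

(** Since [Num.sg 0] is [0], this vanishes on the hyperplanes, and the identities below hold at
    every point rather than almost everywhere. *)
Definition arrangement_sign x : R := \prod_(e <- E) Num.sg (dot e x).

Lemma arrangement_signN x :
  arrangement_sign (- x) = (-1) ^+ #|` E| * arrangement_sign x.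
Proof.
rewrite /arrangement_sign.
under eq_bigr do rewrite dotNr sgrN -mulN1r.
by rewrite big_split /= big_const_seq count_predT iter_mulr_1.
Qed.

Lemma arrangement_sign_eq0 x : arrangement_sign x = 0 <-> ~ complement dot E x.
Proof.
rewrite /arrangement_sign; split => [/eqP|].
  rewrite prodf_seq_eq0 => /hasP[e eE /=]; rewrite sgr_eq0 => /eqP ex.
  by apply; exists e.
move=> /contrapT[e /= eE ex].
by rewrite (big_rem e)//= ex sgr0 mul0r.
Qed.

Hypothesis hE : is_arrangement E.

Lemma arrangement_dot1 e : e \in E -> dot e e = 1.
Proof. by move=> eE; rewrite (dot_norm hdot) hE.1// expr1n. Qed.

Lemma arrangement_collinear e f (k : R) : e \in E -> f \in E -> e = k *: f -> e = f.
Proof.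
move=> eE fE ekf; apply/eqP; apply: contraT => ef.
have := hE.2 e f eE fE ef; rewrite free_cons span_seq1 => /andP[/negP + _].
by case; apply/vlineP; exists k.
Qed.

(** The component [y] of [f] orthogonal to [g] lies on the common hyperplane, hence is also
    orthogonal to [f], and so to itself. Thus [f] is a multiple of [g], by a factor of square 1. *)
Lemma same_hyperplane f g : dot f f = 1 -> dot g g = 1 ->
  hyperplane dot f = hyperplane dot g -> exists s : bool, f = (-1) ^+ s *: g.
Proof.
move=> f1 g1 fg; pose y := f - dot g f *: g.
have gy : dot g y = 0 by rewrite /y dotBr dotZr g1 mulr1 subrr.
have fy : dot f y = 0 by have : hyperplane dot f y by rewrite fg.
have y0 : y = 0.
  apply/eqP; apply: contraT => /(dot_gt0 dot).
  by rewrite {1}/y dotBl dotZl fy gy mulr0 subrr ltxx.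
have fE : f = dot g f *: g by move/eqP: y0; rewrite subr_eq0 => /eqP.
have : dot g f ^+ 2 = 1.
  by rewrite -[RHS]f1 [in RHS]fE dotZl dotZr g1 mulr1.
move=> /eqP; rewrite sqrf_eq1 => /orP[]/eqP c; rewrite c in fE.
  by exists false; rewrite expr0.
by exists true; rewrite expr1.
Qed.

Hypothesis hC : forall e f, e \in E -> f \in E ->
  exists2 g, g \in E & reflection dot e @` hyperplane dot f = hyperplane dot g.

(** The image of the hyperplane of [f] is the hyperplane of the reflected [f], and two unit normals
    of one hyperplane differ by a sign. *)
Lemma reflection_permutes e f : e \in E -> f \in E ->
  exists g : V, exists s : bool, g \in E /\ reflection dot e f = (-1) ^+ s *: g.
Proof.
move=> eE fE; have [g gE seg] := hC eE fE.
have e0 : e != 0 by rewrite -normr_gt0 hE.1.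
have [] := @same_hyperplane (reflection dot e f) g.
- by rewrite dot_reflection// arrangement_dot1.
- exact: arrangement_dot1.
- rewrite -seg; apply/seteqP; split => [x /= fx|_ [x /= fx <-]].
    exists (reflection dot e x); last exact: reflectionK.
    by rewrite /hyperplane /= dot_reflectionr.
  by rewrite /hyperplane /= dot_reflection.
- by move=> s seE; exists g, s.
Qed.

(* Every reflection permutes the other hyperplanes, so it multiplies the product
   of the remaining signs by a constant, which is read off at a fixed point. *)
Lemma arrangement_sign_reflection e x : e \in E ->
  arrangement_sign (reflection dot e x) = - arrangement_sign x.
Proof.
move=> eE; have e0 : e != 0 by rewrite -normr_gt0 hE.1.
have e1 := arrangement_dot1 eE.
have rK := reflectionK dot e0.
pose E' := rem e E.
have uE' : uniq E' by rewrite rem_uniq ?fset_uniq.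
have E'E f : f \in E' -> f \in E /\ f != e.
  by rewrite (mem_rem_uniq e (fset_uniq E)) !inE => /andP[].
have re : reflection dot e e = - e.
  rewrite /reflection e1 divr1 mulr1 scaler_nat mulr2n opprD addrA subrr.
  by rewrite sub0r.
(* Of the two opposite vectors [reflection dot e f] and its negative, [pi f] is the one in [E], and
   [eps f] records whether a sign was changed. *)
pose pi f := if reflection dot e f \in E then reflection dot e f
  else - reflection dot e f.
pose eps f : bool := reflection dot e f \notin E.
have piE f : reflection dot e f = (-1) ^+ eps f *: pi f.
  rewrite /eps /pi; case: (_ \in E); rewrite ?expr0 ?scale1r//.
  by rewrite expr1 scaleN1r opprK.
have pi_in f : f \in E' -> pi f \in E'.
  move=> /E'E[fE fe]; have piE1 : pi f \in E.
    have [g [s [gE rg]]] := reflection_permutes eE fE.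
    rewrite /pi; case: ifPn => // /negP rE; move: rE; rewrite rg.
    case: s rg => rg; last by rewrite expr0 scale1r.
    by rewrite expr1 scaleN1r opprK.
  rewrite (mem_rem_uniq e (fset_uniq E)) !inE piE1 andbT.
  (* If [pi f] were [e], then [f] would be a multiple of the reflection of [e], which is [- e]. *)
  apply: contra fe => /eqP pie; apply/eqP.
  apply: (@arrangement_collinear _ _ (- (-1) ^+ eps f)) => //.
  by rewrite -{1}(rK f) (piE f) pie reflectionZ re scalerN scaleNr.
have pi_inj : {in E' &, injective pi}.
  move=> f g fE' gE' fg; apply: (@arrangement_collinear _ _ ((-1) ^+ eps f * (-1) ^+ eps g)).
  - by have [] := E'E _ fE'.
  - by have [] := E'E _ gE'.
  - rewrite -{1}(rK f) (piE f) fg reflectionZ -scalerA; congr (_ *: _).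
    have -> : pi g = (-1) ^+ eps g *: reflection dot e g.
      by rewrite (piE g) scalerA -expr2 sqrr_sign scale1r.
    by rewrite reflectionZ rK.
have pi_perm : perm_eq [seq pi f | f <- E'] E'.
  apply: uniq_perm => //; first by rewrite map_inj_in_uniq.
  have [] := @uniq_min_size _ [seq pi f | f <- E'] E'; rewrite ?map_inj_in_uniq ?size_map//.
  by move=> _ /mapP[f fE' ->]; exact: pi_in.
pose sigma' y : R := \prod_(f <- E') Num.sg (dot f y).
have sigma'r y : sigma' (reflection dot e y) = (\prod_(f <- E') (-1) ^+ eps f) * sigma' y.
  have -> : sigma' y = \prod_(f <- E') Num.sg (dot (pi f) y).
    by rewrite /sigma' -(perm_big _ pi_perm) big_map.
  rewrite -big_split /=.
  apply: eq_bigr => f _.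
  rewrite dot_reflectionr piE dotZl sgrM; congr (_ * _).
  by case: (eps f); rewrite ?expr0 ?expr1 ?sgrN ?sgr1.
(* Projecting a generic [d] to the hyperplane of [e] gives a point [y] on no other hyperplane. The
   reflection fixes [y] and [sigma' y] is nonzero, so the constant is 1. *)
have [d dP] : exists d, all (fun v => dot v d != 0) [seq f - dot e f *: e | f <- E'].
  apply: exists_nonorthogonal; apply/allP => _ /mapP[f /E'E[fE fe] ->].
  apply: contra fe; rewrite subr_eq0 => /eqP fE1; apply/eqP.
  exact: arrangement_collinear fE1.
pose y := d - dot e d *: e.
have sy : sigma' y != 0.
  rewrite prodf_seq_neq0; apply/allP => f fE' /=; rewrite sgr_eq0.
  have := allP dP _ (map_f (fun f => f - dot e f *: e) fE').
  by rewrite /y /= dotBr dotZr dotBl dotZl (dotC dot f e) [dot e d * _]mulrC.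
have ry : reflection dot e y = y.
  by apply: reflection_fix; rewrite /y dotBr dotZr e1 mulr1 subrr.
have c1 : \prod_(f <- E') (-1) ^+ eps f = 1 :> R.
  by apply: (mulIf sy); rewrite -sigma'r ry mul1r.
rewrite /arrangement_sign !(big_rem e eE)/= -!/(sigma' _) sigma'r c1 mul1r.
by rewrite dot_reflectionr re dotNl sgrN mulNr.
Qed.

End sign_function.

Section chambers.
Context {R : realType} {V : normedVectType R} (dot : {dot V for idfun}).
Hypothesis hdot : inner_norm dot.
Variable E : {fset V}.
Implicit Types (e x y : V) (T : set V).

(** The open polyhedral cone with the sign vector of [x]; it is empty when [x] lies on a
    hyperplane. *)
Definition cell x : set V := [set y | forall e, e \in E -> 0 < dot e x * dot e y].

Lemma complementP x : complement dot E x <-> forall e, e \in E -> dot e x != 0.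
Proof.
split => [cx e eE|h [e /= eE ex]]; last by have := h e eE; rewrite ex eqxx.
by apply/negP => /eqP ex; apply: cx; exists e.
Qed.

Lemma cell_refl x : complement dot E x -> cell x x.
Proof. by move=> /complementP cx e eE; rewrite -expr2 exprn_even_gt0//= cx. Qed.

Lemma cell_sub_complement x : cell x `<=` complement dot E.
Proof.
move=> y xy; apply/complementP => e eE.
by apply: contraTneq (xy e eE) => ->; rewrite mulr0 ltxx.
Qed.

(** By the intermediate value property [dot e] keeps its sign on a connected set that avoids the
    hyperplane of [e]. Conversely, the segment from [x] to a point of its cell stays in the cell. *)
Lemma connected_component_cell x : complement dot E x ->
  connected_component (complement dot E) x = cell x.
Proof.
move=> cx; have /complementP cx' := cx.
apply/seteqP; split => y.
  move=> xy e eE.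
  have Cc : connected (connected_component (complement dot E) x).
    exact: component_connected.
  have := connected_continuous_connected (f := dot e) Cc
    (continuous_subspaceT (@continuous_dot _ _ _ hdot e)).
  move=> /connected_intervalP itv.
  rewrite ltNge; apply/negP => le0.
  have ex := cx' e eE.
  have fx : (dot e @` connected_component (complement dot E) x) (dot e x).
    by exists x => //; exact: connected_component_refl.
  have fy : (dot e @` connected_component (complement dot E) x) (dot e y) by exists y.
  suff [z /connected_component_sub/complementP/(_ _ eE) + z0] :
      (dot e @` connected_component (complement dot E) x) 0.
    by rewrite z0 eqxx.
  have [x0|x0] := ltP (dot e x) 0.
    apply: (itv _ _ fx fy); rewrite (ltW x0)/=.
    by move: le0; rewrite nmulr_rle0.
  have {}x0 : 0 < dot e x by rewrite lt_neqAle eq_sym ex.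
  by apply: (itv _ _ fy fx); rewrite (ltW x0) andbT; move: le0; rewrite pmulr_rle0.
move=> xy; pose g (t : R) : V := x + t *: (y - x).
have gc : continuous g.
  move=> t; apply: cvgD; first exact: cvg_cst.
  by apply: cvgZr_tmp; exact: cvg_id.
have gI : connected (g @` `[0, 1]).
  apply: connected_continuous_connected; first exact: segment_connected.
  exact: continuous_subspaceT.
have sub : g @` `[0, 1] `<=` complement dot E.
  move=> _ [t /= + <-]; rewrite in_itv /= => /andP[t0 t1].
  apply: (@cell_sub_complement x) => e eE.
  rewrite /g dotDr dotZr dotBr.
  have ex : 0 < dot e x * dot e x by rewrite -expr2 exprn_even_gt0//= cx'.
  rewrite (_ : _ * _ = (1 - t) * (dot e x * dot e x) + t * (dot e x * dot e y)); last by ring.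
  (* At [t = 1] the first summand vanishes, so strict positivity has to come from the second. *)
  have [->|tn1] := eqVneq t 1; first by rewrite subrr mul0r add0r mul1r xy.
  rewrite ltr_pwDl//; last by rewrite mulr_ge0// ltW// xy.
  by rewrite mulr_gt0// subr_gt0 lt_neqAle tn1.
apply: (connected_component_max _ sub gI).
  by exists 0; [rewrite /= in_itv /= lexx ler01|rewrite /g scale0r addr0].
by exists 1; [rewrite /= in_itv /= lexx ler01|rewrite /g scale1r addrC subrK].
Qed.

Lemma chambersP T : chambers dot E T <-> exists2 x, complement dot E x & T = cell x.
Proof.
split => [[x cx <-]|[x cx ->]]; first by exists x => //; exact: connected_component_cell.
by exists x => //; exact: connected_component_cell.
Qed.

Lemma eq_cell x y : cell x y -> cell x = cell y.
Proof.
move=> xy; apply/seteqP; split => z h e eE; have := xy e eE; have := h e eE.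
  move=> xz xy'; have : 0 < (dot e x * dot e z) * (dot e x * dot e y) by rewrite mulr_gt0.
  rewrite (_ : _ * _ = (dot e x) ^+ 2 * (dot e y * dot e z)); last by ring.
  have x0 : dot e x != 0 by apply: contraTneq xz => ->; rewrite mul0r ltxx.
  by rewrite pmulr_rgt0// exprn_even_gt0.
move=> yz xy'; have : 0 < (dot e x * dot e y) * (dot e y * dot e z) by rewrite mulr_gt0.
rewrite (_ : _ * _ = (dot e y) ^+ 2 * (dot e x * dot e z)); last by ring.
have y0 : dot e y != 0 by apply: contraTneq yz => ->; rewrite mul0r ltxx.
by rewrite pmulr_rgt0// exprn_even_gt0.
Qed.

(** A chamber is determined by its sign vector, and there are finitely many of these. *)
Lemma finite_chambers : finite_set (chambers dot E).
Proof.
pose h (g : {ffun E -> bool}) : set V :=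
  [set y | forall e : E, 0 < (-1) ^+ g e * dot (val e) y].
apply: (@sub_finite_set _ _ (h @` setT)); last exact/finite_image/finite_finset.
move=> T /chambersP[x cx ->]; exists [ffun e : E => dot (val e) x < 0] => //.
have sgE e y : e \in E -> (0 < (-1) ^+ (dot e x < 0)%R * dot e y) = (0 < dot e x * dot e y).
  move=> eE; have /complementP/(_ e eE) := cx.
  by case: (ltgtP (dot e x) 0) => // ex _; rewrite ?expr1 ?expr0 ?mul1r ?mulN1r ?oppr_gt0
    ?(pmulr_rgt0 _ ex) ?(nmulr_rgt0 _ ex).
apply/seteqP; split => y hy.
  by move=> e eE; have := hy [` eE]%fset; rewrite ffunE /= sgE.
by move=> e; rewrite ffunE sgE ?fsvalP//; exact: hy (fsvalP e).
Qed.

Lemma cell_cone x : cone (cell x).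
Proof.
by move=> k y k0; split => h e eE; have := h e eE;
  by rewrite dotZr mulrCA (pmulr_rgt0 _ k0).
Qed.

Lemma measurable_cell (b : (\dim {:V}).-tuple V) x : orthonormal dot b ->
  measurable (cell x : set (measV b)).
Proof.
move=> hb.
rewrite (_ : cell x = \bigcap_(e in [set` E]) [set y | 0 < dot e x * dot e y]).
  apply: fin_bigcap_measurable => // e _.
  rewrite (_ : [set y | _] = (fun y : measV b => 0 < dot e x * dot e y) @^-1` [set true]).
    rewrite -[X in measurable X]setTI; apply: measurable_fun_ltr => //.
    by apply: measurable_funM => //; exact: measurable_dot.
  by apply/seteqP; split => y.
by apply/seteqP; split => y h e; exact: h.
Qed.

Variable T0 : set V.
Hypothesis hT0 : is_base_chamber dot E T0.

(** As [T0] is on the positive side of every hyperplane, the separating ones are those with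
    [dot e y < 0]. Both chambers are nonempty, so the inclusions in [opposite_sides] can be tested
    at a point of each. *)
Lemma chamber_signE x y : complement dot E x -> cell x y ->
  chamber_sign dot E T0 (cell x) = arrangement_sign dot E y.
Proof.
move=> cx xy; have /complementP cy := cell_sub_complement xy.
have [T0c T0pos] := hT0.
have [x0 T0x0] : exists x0, T0 x0.
  by have /chambersP[x0 cx0 ->] := T0c; exists x0; exact: cell_refl.
have oppE e : e \in E -> `[< opposite_sides dot e (cell x) T0 >] = (dot e y < 0).
  move=> eE; apply/idP/idP => [/asboolP[[_ /(_ _ T0x0)]|[/(_ _ xy)]]|ey] //=.
    by rewrite ltNge (ltW (T0pos _ _ eE T0x0)).
  apply/asboolP; right; split; last by move=> z; exact: T0pos.
  by move=> z; rewrite (eq_cell xy) => /(_ e eE); rewrite nmulr_rgt0.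
rewrite /chamber_sign /arrangement_sign.
transitivity (\prod_(e <- E) (if dot e y < 0 then -1 else 1 : R)).
  rewrite -big_mkcond /= big_const_seq iter_mulr_1; congr (_ ^+ _).
  rewrite -size_filter; apply/perm_size/uniq_perm.
  - exact: fset_uniq.
  - by rewrite filter_uniq ?fset_uniq.
  move=> e; rewrite mem_filter !inE /= andbC.
  by case: (boolP (e \in E)) => eE; rewrite ?andbF ?andbT//= oppE.
rewrite big_seq [RHS]big_seq; apply: eq_bigr => e eE.
have := cy e eE; case: (ltgtP (dot e y) 0) => // ey _.
  by rewrite ltr0_sg.
by rewrite gtr0_sg.
Qed.

End chambers.

(** * The pizza quantity as an integral over the unit ball *)

Section pizza_integral.
Context {R : realType} {V : normedVectType R} (dot : {dot V for idfun}).
Hypothesis hdot : inner_norm dot.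
Variable b : (\dim {:V}).-tuple V.
Hypothesis hb : orthonormal dot b.
Local Notation mV := (measV b).
Local Notation n := (\dim {:V}).
Variable mu : {sigma_finite_measure set mV -> \bar R}.
Hypothesis muE : forall A, mu A = Vol b A.
Variable E : {fset V}.
Variable T0 : set V.
Hypothesis hT0 : is_base_chamber dot E T0.
Implicit Types (a x : V) (c r : R).

(** The larger root [s] of [s^2 - 2 t s - c = 0] with [t = unit_dot dot a x]; for [c = r^2 - |a|^2]
    this is the distance from the origin to the sphere in the direction of [x]. *)
Definition rho a c x : R :=
  unit_dot dot a x + Num.sqrt (unit_dot dot a x ^+ 2 + c).

Lemma rho_ge0 a c x : 0 <= c -> 0 <= rho a c x.
Proof.
move=> c0; rewrite /rho -lerBlDl sub0r (le_trans (ler_norm _))// normrN.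
by rewrite -sqrtr_sqr ler_wsqrtr// lerDl.
Qed.

Lemma bm_rho a c : bounded_measurable b (rho a c).
Proof.
have bu := bm_unit_dot hdot hb a.
apply: bm_add => //.
have [mf [M fM]] : bounded_measurable b (fun x => unit_dot dot a x ^+ 2 + c).
  by apply: bm_add; [exact: bm_exp|exact: bm_cst].
split.
  apply: (measurableT_comp _ mf).
  by apply: continuous_measurable_fun; exact: sqrt_continuous.
exists (Num.sqrt M) => x; rewrite ger0_norm ?sqrtr_ge0//.
by rewrite ler_wsqrtr// (le_trans (ler_norm _)).
Qed.

Lemma rho_homogeneous a c : homogeneous0 (rho a c).
Proof. by move=> k x k0; rewrite /rho unit_dot_homogeneous. Qed.

Lemma bm_arrangement_sign : bounded_measurable b (arrangement_sign dot E).
Proof.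
apply: bm_prod => e; split.
  apply: measurableT_comp; last exact: measurable_dot.
  apply: nondecreasing_measurable => // x y xy.
  case: (sgrP x) xy => [->|x0|x0] xy; case: (sgrP y) => [y0|y0|y0] //;
  by rewrite ?lexx ?ler01 ?lerN10// ?ler0N1//; lra.
by exists 1 => x; rewrite normr_sg; case: (_ != 0) => /=; rewrite ?lexx ?ler01.
Qed.

(** Completing the square turns [|x - a| <= r] into [|s - t| <= sqrt (t^2 + c)]. Only the upper
    bound on [s] is a constraint: since [c >= 0], the lower bound [t - sqrt (t^2 + c)] is at most
    0. *)
Lemma cball_rho a r x : `|a| <= r ->
  cball a r x <-> `|x| <= rho a (r ^+ 2 - `|a| ^+ 2) x.
Proof.
move=> ar; have r0 : 0 <= r := le_trans (normr_ge0 a) ar.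
set c := r ^+ 2 - _; set t := unit_dot dot a x; set s := `|x|.
have c0 : 0 <= c by rewrite subr_ge0 ler_sqr ?nnegrE.
have ts : dot a x = t * s.
  rewrite /t /unit_dot /s; have [->|x0] := eqVneq x 0.
    by rewrite normr0 mulr0 dot0r.
  by rewrite divfK ?normr_eq0.
have h : cball a r x <-> `|s - t| <= Num.sqrt (t ^+ 2 + c).
  rewrite /cball /=; rewrite -[in X in X <-> _]ler_sqr ?nnegrE//.
  rewrite -[in X in _ <-> X]ler_sqr ?nnegrE ?sqrtr_ge0// sqr_sqrtr;
    last by rewrite addr_ge0 ?sqr_ge0.
  rewrite -(dot_norm hdot (x - a)) dotBl !dotBr (dotC dot x a) ts !(dot_norm hdot).
  rewrite -normrX ger0_norm ?sqr_ge0// -/s /c.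
  have -> : (s - t) ^+ 2 = s ^+ 2 - t * s - t * s + t ^+ 2 by ring.
  by split => h; lra.
apply: (iff_trans h); rewrite ler_norml /rho -/t; split => [/andP[_ {}h]|{}h].
  by rewrite addrC -lerBlDr.
apply/andP; split; last by rewrite lerBlDr addrC.
rewrite -subr_ge0 opprK -addrA addr_ge0 ?normr_ge0//.
rewrite addrC subr_ge0 (le_trans (ler_norm _))// -sqrtr_sqr ler_wsqrtr// lerDl//.
Qed.

(** Each chamber is a cone, so [polar] applies to its part of the ball. The signed indicators of the
    chambers then add up to [arrangement_sign]: a point of the complement lies in exactly one
    chamber, and elsewhere both sides vanish. *)
Lemma pizzaE a r : `|a| <= r -> pizza dot b E T0 (cball a r) =
  ballint mu (fun x => arrangement_sign dot E x * rho a (r ^+ 2 - `|a| ^+ 2) x ^+ n).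
Proof.
move=> ar; set c := r ^+ 2 - _.
have c0 : 0 <= c.
  by rewrite subr_ge0 ler_sqr ?nnegrE//; exact: le_trans (normr_ge0 a) ar.
rewrite /pizza fsbig_finite; last exact: finite_chambers.
have inF T : T \in fset_set (chambers dot E) ->
    exists2 x, complement dot E x & T = cell dot E x.
  rewrite in_fset_set; last exact: finite_chambers.
  by rewrite inE => /(chambersP hdot).
have brho : bounded_measurable b (fun x => rho a c x ^+ n) by apply: bm_exp; exact: bm_rho.
have mT T : T \in fset_set (chambers dot E) -> measurable (T : set mV).
  by move=> /inF[x cx ->]; exact: measurable_cell.
transitivity (ballint mu (fun x => \sum_(T <- fset_set (chambers dot E))
    (chamber_sign dot E T0 T * (\1_T x * rho a c x ^+ n)))).
  rewrite (ballint_sum hdot hb muE); last first.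
    move=> T TF; apply: bm_mul; first exact: bm_cst.
    by apply: bm_mul => //; exact: bm_indic (mT T TF).
  rewrite big_seq [RHS]big_seq; apply: eq_bigr => T TF.
  rewrite (ballintZ hdot hb muE); last by apply: bm_mul => //; exact: bm_indic (mT T TF).
  congr (_ * _).
  have [x cx TE] := inF _ TF.
  have [mrho [M rhoM]] := bm_rho a c.
  rewrite -muE (_ : _ `&` _ = [set x | T x /\ `|x : V| <= rho a c x]); last first.
    by apply/seteqP; split => y [] => [/(cball_rho _ ar)|? /(cball_rho _ ar)].
  rewrite (polar hdot hb muE (M := M))//; first last.
  - by move=> y; rewrite rho_ge0//= (le_trans (ler_norm _)).
  - exact: rho_homogeneous.
  - by rewrite TE; exact: cell_cone.
  - exact: mT.
  rewrite -[LHS]/(\int[mu]_(y in T `&` (cball (0 : V) (1 : R))) (rho a c y ^+ n)).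
  rewrite Rintegral_mkcondl /ballint; apply: eq_Rintegral => y _.
  rewrite patchE indicE; case: (y \in T); first by rewrite mul1r.
  by rewrite mul0r.
congr ballint; apply/funext => x.
have [cx|ncx] := pselect (complement dot E x); last first.
  have /arrangement_sign_eq0 -> := ncx; rewrite mul0r big_seq big1// => T.
  move=> /inF[y cy TE]; rewrite indicE memNset ?mul0r ?mulr0//.
  by rewrite TE => /cell_sub_complement.
have xF : cell dot E x \in fset_set (chambers dot E).
  rewrite in_fset_set; last exact: finite_chambers.
  by rewrite inE; apply/(chambersP hdot); exists x.
rewrite (big_fsetD1 _ xF)/= big_seq big1 ?addr0.
  rewrite indicE mem_set ?mul1r; last exact: cell_refl.
  by rewrite (chamber_signE hdot hT0 cx (cell_refl cx)).
move=> T; rewrite !inE => /andP[Tx /inF[y cy TE]].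
rewrite indicE memNset ?mul0r ?mulr0// => xT.
by move/eqP: Tx; apply; rewrite TE; apply: eq_cell; rewrite -TE.
Qed.

End pizza_integral.

(** * Powers of the radial function *)

Section power_sum_polynomial.
Variable R : rcfType.
Implicit Types (c t s : R) (m : nat).

(** The power sums of the two roots of [u^2 = 2 t u + c], as polynomials in [t]. Multiplying this
    equation by [u^m] and adding over the roots gives the recurrence. *)
Fixpoint power_sum_poly c m : {poly R} :=
  match m with
  | 0 => 2%:P
  | m1.+1 => match m1 with
             | 0 => 2 *: 'X
             | m2.+1 => 2 *: ('X * power_sum_poly c m1) + c *: power_sum_poly c m2
             end
  end.

Lemma power_sum_polyE c t s m : s ^+ 2 = t ^+ 2 + c ->
  (power_sum_poly c m).[t] = (t + s) ^+ m + (t - s) ^+ m.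
Proof.
move=> sE; have cE : c = s ^+ 2 - t ^+ 2 by rewrite sE addrAC subrr add0r.
suff : (power_sum_poly c m).[t] = (t + s) ^+ m + (t - s) ^+ m /\
  (power_sum_poly c m.+1).[t] = (t + s) ^+ m.+1 + (t - s) ^+ m.+1 by case.
elim: m => [|m [IH1 IH2]].
  by rewrite /= hornerC hornerZ hornerX !expr0 !expr1; split; ring.
split => //.
have -> : power_sum_poly c m.+2 =
  2 *: ('X * power_sum_poly c m.+1) + c *: power_sum_poly c m by [].
rewrite hornerD !hornerZ hornerM hornerX IH1 IH2 {IH1 IH2} !exprS cE; ring.
Qed.

Lemma size_power_sum_poly c m : (size (power_sum_poly c m) <= m.+1)%N.
Proof.
suff : (size (power_sum_poly c m) <= m.+1)%N /\
  (size (power_sum_poly c m.+1) <= m.+2)%N by case.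
elim: m => [|m [IH1 IH2]].
  split; first exact: size_polyC_leq1.
  by rewrite (leq_trans (size_scale_leq _ _))// size_polyX.
split => //.
have -> : power_sum_poly c m.+2 =
  2 *: ('X * power_sum_poly c m.+1) + c *: power_sum_poly c m by [].
rewrite (leq_trans (size_polyD _ _))// geq_max; apply/andP; split.
  rewrite (leq_trans (size_scale_leq _ _))// (leq_trans (size_polyMleq _ _))//.
  by rewrite size_polyX.
rewrite (leq_trans (size_scale_leq _ _))// (leq_trans IH1)//.
exact: leqW.
Qed.

(** In the recurrence the term with factor [c] has too low a degree to reach the top coefficient,
    which is thus independent of [c]. The difference therefore drops one degree, as the case of
    exactly [n] hyperplanes requires. *)
Lemma size_power_sum_polyB c c' m :
  (size (power_sum_poly c m - power_sum_poly c' m)%R <= m)%N.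
Proof.
have coefE : (power_sum_poly c m)`_m = (power_sum_poly c' m)`_m.
  suff : (power_sum_poly c m)`_m = (power_sum_poly c' m)`_m /\
    (power_sum_poly c m.+1)`_m.+1 = (power_sum_poly c' m.+1)`_m.+1 by case.
  elim: m => [|m [IH1 IH2]] //; split => //.
  have E d : (power_sum_poly d m.+2)`_m.+2 = 2 * (power_sum_poly d m.+1)`_m.+1.
    have -> : power_sum_poly d m.+2 =
      2 *: ('X * power_sum_poly d m.+1) + d *: power_sum_poly d m by [].
    rewrite coefD !coefZ coefXM /= [X in d * X]nth_default ?mulr0 ?addr0//.
    exact: leqW (size_power_sum_poly d m).
  by rewrite !E IH2.
apply/leq_sizeP => j mj; rewrite coefB.
have [->|jm] := eqVneq j m; first by rewrite coefE subrr.
have {}mj : (m < j)%N by rewrite ltn_neqAle eq_sym jm.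
by rewrite !nth_default ?subrr// (leq_trans (size_power_sum_poly _ _)).
Qed.

End power_sum_polynomial.

(** * Taylor approximation of powers of the radial function *)

Section polynomial_approximation.
Variable R : rcfType.
Implicit Types (f g : R -> R) (p q : {poly R}) (tau : R) (N : nat).

(** A Taylor expansion at 0 stated without derivatives, with a remainder constant uniform on
    [[-1, 1]]. *)
Definition poly_approx N f p := exists C : R,
  0 <= C /\ forall tau, `|tau| <= 1 -> `|f tau - p.[tau]| <= C * `|tau| ^+ N.

Lemma horner_bound p tau : `|tau| <= 1 -> `|p.[tau]| <= \sum_(i < size p) `|p`_i|.
Proof.
move=> tau1; rewrite horner_coef (le_trans (ler_norm_sum _ _ _))//.
apply: ler_sum => i _; rewrite normrM normrX -[leRHS]mulr1 ler_wpM2l//.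
by rewrite exprn_ile1.
Qed.

Lemma poly_approxM N f g p q : poly_approx N f p -> poly_approx N g q ->
  poly_approx N (fun tau => f tau * g tau) (p * q).
Proof.
move=> [C [C0 fp]] [D [D0 gq]].
set P := \sum_(i < size p) `|p`_i|; set Q := \sum_(i < size q) `|q`_i|.
have P0 : 0 <= P by exact: sumr_ge0.
have Q0 : 0 <= Q by exact: sumr_ge0.
exists (C * (D + Q) + P * D); split.
  by rewrite addr_ge0 ?mulr_ge0 ?addr_ge0.
move=> tau tau1.
have tN0 : 0 <= `|tau| ^+ N by rewrite exprn_ge0.
have tN1 : `|tau| ^+ N <= 1 by rewrite exprn_ile1.
have fpt := fp _ tau1; have gqt := gq _ tau1.
have pP := horner_bound p tau1; have qQ := horner_bound q tau1.
have gDQ : `|g tau| <= D + Q.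
  rewrite -[g tau](subrK q.[tau]) (le_trans (ler_normD _ _))// lerD//.
  by rewrite (le_trans gqt)// -[leRHS]mulr1 ler_wpM2l.
rewrite hornerM.
rewrite (_ : _ - _ = (f tau - p.[tau]) * g tau + p.[tau] * (g tau - q.[tau])); last by ring.
rewrite (le_trans (ler_normD _ _))// [leRHS]mulrDl !normrM lerD//.
  by rewrite mulrAC ler_pM.
by rewrite -mulrA ler_pM.
Qed.

Lemma poly_approx_exp N f p m : poly_approx N f p ->
  poly_approx N (fun tau => f tau ^+ m) (p ^+ m).
Proof.
move=> fp; elim: m => [|m IH].
  exists 0; split => // tau _; rewrite !expr0 hornerC subrr normr0.
  by rewrite mul0r.
rewrite exprS; under [fun tau => _]eq_fun do rewrite exprS.
exact: poly_approxM.
Qed.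

(** The discarded part of [p] is a multiple of [tau ^+ N] and is absorbed in the error. *)
Lemma poly_approx_take N f p : poly_approx N f p -> poly_approx N f (take_poly N p).
Proof.
move=> [C [C0 fp]]; set D := \sum_(i < size (drop_poly N p)) `|(drop_poly N p)`_i|.
have D0 : 0 <= D by exact: sumr_ge0.
exists (C + D); split; first exact: addr_ge0.
move=> tau tau1.
have -> : f tau - (take_poly N p).[tau] =
    (f tau - p.[tau]) + (drop_poly N p).[tau] * tau ^+ N.
  rewrite -{2}(poly_take_drop N p) hornerD hornerM hornerXn; ring.
rewrite (le_trans (ler_normD _ _))// [leRHS]mulrDl lerD ?fp//.
by rewrite normrM normrX ler_wpM2r ?exprn_ge0// horner_bound.
Qed.

(* [y = sqrt (1 + tau^2) - 1] is a fixed point of [y = (tau^2 - y^2) / 2], and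
   iterating this equation gains one order of approximation per step. *)
Lemma sqrt_poly_approx N :
  exists p, poly_approx N.+1 (fun tau => Num.sqrt (1 + tau ^+ 2)) p.
Proof.
pose y tau : R := Num.sqrt (1 + tau ^+ 2) - 1.
have yE tau : y tau = (tau ^+ 2 - y tau ^+ 2) / 2.
  have : Num.sqrt (1 + tau ^+ 2) ^+ 2 = 1 + tau ^+ 2.
    by rewrite sqr_sqrtr// addr_ge0// sqr_ge0.
  by rewrite /y => h; rewrite sqrrB h; field.
have y_le tau : `|y tau| <= `|tau|.
  rewrite /y ger0_norm; last first.
    by rewrite subr_ge0 -{1}sqrtr1 ler_wsqrtr// lerDl sqr_ge0.
  rewrite lerBlDl -[leRHS]ger0_norm ?addr_ge0// -[leRHS]sqrtr_sqr ler_wsqrtr//.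
  rewrite sqrrD expr1n mul1r real_normK ?num_real// -addrA lerD2l lerDr.
  by rewrite mulrn_wge0.
suff [q [C [C0 qC]]] : exists q, poly_approx N.+1 y q.
  exists (1 + q), C; split => // tau tau1; rewrite hornerD hornerC opprD addrA.
  exact: qC.
elim: N => [|N [q [C [C0 qC]]]].
  exists 0, 1; split => // tau _; rewrite horner0 subr0 mul1r expr1.
  exact: y_le.
(* One iteration of the fixed-point map. The new error is the old one times [- (y + q) / 2], and
   [|y + q| <= (2 + C) * |tau|] supplies the extra power and the constant. *)
exists (2^-1 *: ('X^2 - q ^+ 2)), (C * (2 + C) / 2); split.
  by rewrite divr_ge0// mulr_ge0// addr_ge0.
move=> tau tau1; have h := qC _ tau1.
have q_le : `|q.[tau]| <= (1 + C) * `|tau|.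
  rewrite -[q.[tau]](subKr (y tau)) (le_trans (ler_normB _ _))//.
  rewrite mulrDl mul1r lerD ?y_le//.
  rewrite (le_trans h)// ler_wpM2l// exprS -[leRHS]mulr1 ler_wpM2l//.
  by rewrite exprn_ile1.
rewrite yE hornerZ hornerD hornerN hornerXn horner_exp.
rewrite (_ : _ - _ = (y tau - q.[tau]) * (- (y tau + q.[tau])) / 2); last by field.
rewrite !normrM normrN (ger0_norm (x := 2^-1)) ?invr_ge0//.
rewrite [leRHS](_ : _ = (C * `|tau| ^+ N.+1) * ((2 + C) * `|tau|) / 2); last first.
  by rewrite (exprS `|tau| N.+1); field.
rewrite ler_wpM2r ?invr_ge0//.
rewrite ler_pM// (le_trans (ler_normD _ _))//.
by rewrite (_ : (2 + C) * _ = `|tau| + (1 + C) * `|tau|); [rewrite lerD|ring].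
Qed.

(** Truncation keeps the degree at most [n], within reach of the vanishing moments when there are
    more than [n] hyperplanes, while the error has order [n.+1]. *)
Lemma branch_poly_approx n : exists2 p : {poly R}, (size p <= n.+1)%N &
  poly_approx n.+1 (fun tau => (tau + Num.sqrt (1 + tau ^+ 2)) ^+ n) p.
Proof.
have [p [C [C0 pC]]] := sqrt_poly_approx n.
exists (take_poly n.+1 (('X + p) ^+ n)); first exact: size_take_poly.
apply/poly_approx_take/poly_approx_exp; exists C; split => // tau tau1.
by rewrite hornerD hornerX opprD addrACA subrr add0r pC.
Qed.

End polynomial_approximation.

(** * Vanishing and decay for Coxeter arrangements *)

Section coxeter_pizza.
Context {R : realType} {V : normedVectType R} (dot : {dot V for idfun}).
Hypothesis hdot : inner_norm dot.
Variable b : (\dim {:V}).-tuple V.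
Hypothesis hb : orthonormal dot b.
Local Notation mV := (measV b).
Local Notation n := (\dim {:V}).
Variable mu : {sigma_finite_measure set mV -> \bar R}.
Hypothesis muE : forall A, mu A = Vol b A.
Variable E : {fset V}.
Hypothesis hE : is_Coxeter_arrangement dot E.
Local Notation sigma := (arrangement_sign dot E).

Lemma coxeter_ballint_poly_eq0 a (p : {poly R}) : (size p <= #|` E|)%N ->
  ballint mu (fun x => sigma x * p.[unit_dot dot a x]) = 0.
Proof.
move=> pE; have [arrE _ hC] := hE.
apply: (ballint_poly_eq0 hdot hb muE (bm_arrangement_sign dot b E) arrE _ _ pE) => e x eE.
exact: (arrangement_sign_reflection hdot arrE hC).
Qed.

(* Averaging over [x] and [- x] cancels the square roots. *)
Lemma coxeter_ballint_rho a c : #|` E| = n %[mod 2] -> 0 <= c ->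
  2 * ballint mu (fun x => sigma x * rho dot a c x ^+ n) =
  ballint mu (fun x => sigma x * (power_sum_poly c n).[unit_dot dot a x]).
Proof.
move=> par c0.
have bf : bounded_measurable b (fun x => sigma x * rho dot a c x ^+ n).
  apply: bm_mul; first exact: bm_arrangement_sign.
  by apply: bm_exp; exact: (bm_rho hdot hb).
have oppK : involutive (-%R : V -> V) by exact: opprK.
have dotN x y : dot (- x) (- y) = dot x y by rewrite dotNl dotNr opprK.
have oppD : {morph (-%R : V -> V) : x y / x + y} by exact: opprD.
have bfN : bounded_measurable b ((fun x => sigma x * rho dot a c x ^+ n) \o -%R).
  have [mf [M fM]] := bf; split; last by exists M => x; exact: fM.
  exact: (measurableT_comp mf (measurable_linear_isometry hb dotN oppK)).
rewrite mulr_natl mulr2n -{2}(ballint_isometry hdot hb muE oppD dotN oppK bf).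
rewrite -(ballintD hdot hb muE bf bfN); congr ballint; apply/funext => x /=.
set t := unit_dot dot a x; set s := Num.sqrt (t ^+ 2 + c).
rewrite arrangement_signN (power_sum_polyE (s := s)); last first.
  by rewrite sqr_sqrtr// addr_ge0 ?sqr_ge0.
have tN : unit_dot dot a (- x) = - t by rewrite /unit_dot dotNr normrN mulNr.
rewrite /rho tN sqrrN -/t -/s.
(* At [- x] the sign function contributes [(-1) ^+ #|E|], and [rho] becomes [- (t - s)], whose power
   contributes [(-1) ^+ n]; by parity the two signs cancel. *)
have -> : (-1) ^+ #|` E| = (-1) ^+ n :> R.
  by rewrite -signr_odd -[RHS]signr_odd; congr (_ ^+ nat_of_bool _); move: par;
    rewrite !modn2 => /eqP; case: (odd _); case: (odd _).
have -> : - t + s = (-1) * (t - s) by ring.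
rewrite exprMn mulrDr; congr (_ + _).
by rewrite mulrACA -expr2 sqrr_sign mul1r.
Qed.

(** With [tau = t / h], the power of [rho] is [h ^+ n] times a function of [tau] alone. Its
    approximating polynomial of degree at most [n] integrates to 0 against [sigma], and the
    remainder is at most [h ^+ n * C * (|a| / h) ^+ n.+1], of order [1 / h]. *)
Lemma coxeter_ballint_rho_bound a : (n < #|` E|)%N ->
  exists2 K, 0 <= K & forall h, 0 < h -> `|a| <= h ->
    `|ballint mu (fun x => sigma x * rho dot a (h ^+ 2) x ^+ n)| <= K / h.
Proof.
move=> nE; have [p sp [C [C0 pC]]] := branch_poly_approx R n.
have bs := bm_arrangement_sign dot b E.
exists (C * `|a| ^+ n.+1 * fine (mu (cball (0 : V) (1 : R)))).
  by rewrite mulr_ge0 ?mulr_ge0 ?exprn_ge0 ?fine_ge0.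
move=> h h0 ah.
pose P : {poly R} := p \Po (h^-1 *: 'X).
have PE t : P.[t] = p.[t / h] by rewrite horner_comp hornerZ hornerX mulrC.
have sP : (size P <= #|` E|)%N.
  rewrite size_comp_poly2; last by rewrite size_scale ?invr_neq0 ?gt_eqF// size_polyX.
  exact: leq_trans sp nE.
pose G (tau : R) := (tau + Num.sqrt (1 + tau ^+ 2)) ^+ n.
have rhoE x : rho dot a (h ^+ 2) x ^+ n = h ^+ n * G (unit_dot dot a x / h).
  rewrite /G -exprMn mulrDr mulrC divfK ?gt_eqF// /rho; congr ((_ + _) ^+ n).
  rewrite -{2}(ger0_norm (ltW h0)) -sqrtr_sqr -sqrtrM ?sqr_ge0//; congr Num.sqrt.
  by field; rewrite gt_eqF.
pose D x := sigma x * (rho dot a (h ^+ 2) x ^+ n + (- h ^+ n) * P.[unit_dot dot a x]).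
have bP : bounded_measurable b (fun x => P.[unit_dot dot a x]).
  by apply: bm_horner; exact: (bm_unit_dot hdot hb).
have br : bounded_measurable b (fun x => rho dot a (h ^+ 2) x ^+ n).
  by apply: bm_exp; exact: (bm_rho hdot hb).
have bD : bounded_measurable b D.
  by apply: bm_mul => //; apply: bm_add => //; apply: bm_mul => //; exact: bm_cst.
have -> : ballint mu (fun x => sigma x * rho dot a (h ^+ 2) x ^+ n) = ballint mu D.
  rewrite (_ : D = fun x => sigma x * rho dot a (h ^+ 2) x ^+ n +
      (- h ^+ n) * (sigma x * P.[unit_dot dot a x])); last first.
    by apply/funext => x; rewrite /D mulrDr mulrCA.
  rewrite (ballintD hdot hb muE); first last.
  - by apply: bm_mul; [exact: bm_cst|exact: bm_mul].
  - exact: bm_mul.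
  rewrite (ballintZ hdot hb muE); last exact: bm_mul.
  by rewrite coxeter_ballint_poly_eq0// mulr0 addr0.
have DM x : `|D x| <= C * `|a| ^+ n.+1 / h.
  rewrite /D rhoE PE mulNr -mulrBr !normrM normrX (gtr0_norm h0).
  have s1 : `|sigma x| <= 1.
    rewrite /arrangement_sign normr_prod; apply: prodr_ile1 => e _.
    by rewrite normr_ge0 normr_sg; case: (_ != 0) => /=; rewrite ?lexx ?ler01.
  have ut := unit_dot_bound hdot a x.
  have t1 : `|unit_dot dot a x / h| <= 1.
    by rewrite normrM normfV (gtr0_norm h0) ler_pdivrMr// mul1r (le_trans ut).
  rewrite -[leRHS]mul1r ler_pM ?mulr_ge0 ?exprn_ge0 ?(ltW h0)//.
  apply: (@le_trans _ _ (h ^+ n * (C * `|unit_dot dot a x / h| ^+ n.+1))).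
    by rewrite ler_wpM2l ?exprn_ge0 ?(ltW h0)//; exact: pC.
  apply: (@le_trans _ _ (h ^+ n * (C * (`|a| / h) ^+ n.+1))).
    rewrite ler_wpM2l ?exprn_ge0 ?(ltW h0)// ler_wpM2l// lerXn2r ?nnegrE ?divr_ge0 ?(ltW h0)//.
    by rewrite normrM normfV (gtr0_norm h0) ler_wpM2r ?invr_ge0 ?(ltW h0).
  rewrite exprMn exprVn (exprS h) le_eqVlt; apply/orP; left; apply/eqP; field.
  by rewrite expf_neq0 gt_eqF.
by rewrite (le_trans (ballint_bound hdot hb muE bD DM))// mulrAC.
Qed.

End coxeter_pizza.

Theorem theorem1p1 (R : realType) (V : normedVectType R)
    (dot : {dot V for idfun}) (hdot : inner_norm dot)
    (b : (\dim {:V}).-tuple V) (hb : orthonormal dot b)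
    (E : {fset V}) (hE : is_Coxeter_arrangement dot E)
    (T0 : set V) (hT0 : is_base_chamber dot E T0)
    (hcard : (\dim {:V} <= #|` E|)%N) :
  [/\ (* (i) *)
      (\dim {:V} < #|` E|)%N -> #|` E| = \dim {:V} %[mod 2] ->
      forall (a : V) (r : R), `|a| <= r ->
        pizza dot b E T0 (cball a r) = 0,
      (* (ii) *)
      (\dim {:V} < #|` E|)%N -> #|` E| <> \dim {:V} %[mod 2] ->
      forall a : V, pizza dot b E T0 (cball a r) @[r --> +oo] --> (0 : R)
    & (* (iii) *)
      #|` E| = \dim {:V} ->
      forall (a : V) (r r' : R), `|a| <= r -> `|a| <= r' ->
        pizza dot b E T0 (cball a r) = pizza dot b E T0 (cball a r')].
Proof.
have [mu muE] := Vol_sigma_finite_measure hb.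
have c_ge0 (a : V) (r : R) : `|a| <= r -> 0 <= r ^+ 2 - `|a| ^+ 2.
  by move=> ar; rewrite subr_ge0 ler_sqr ?nnegrE//; exact: le_trans (normr_ge0 a) ar.
split.
- move=> nE par a r ar; rewrite (pizzaE hdot hb muE hT0 ar).
  have := coxeter_ballint_rho hdot hb muE a par (c_ge0 a r ar).
  rewrite (coxeter_ballint_poly_eq0 hdot hb muE hE); last first.
    exact: leq_trans (size_power_sum_poly _ _) nE.
  by move/eqP; rewrite mulf_eq0 pnatr_eq0 /= => /eqP.
- move=> nE _ a.
  have [K K0 HK] := coxeter_ballint_rho_bound hdot hb muE hE a nE.
  apply/cvgrPdist_le => eps eps0; near=> r.
  have ar : `|a| <= r by near: r; exact: nbhs_pinfty_ge.
  have r0 : 0 < r - `|a|.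
    by rewrite subr_gt0; near: r; apply: nbhs_pinfty_gt; exact: num_real.
  (* This gives [|a| <= r - |a|], and hence the condition [|a| <= sqrt c] of the bound. *)
  have r2 : `|a| + `|a| <= r.
    by near: r; apply: nbhs_pinfty_ge; exact: num_real.
  rewrite sub0r normrN (pizzaE hdot hb muE hT0 ar).
  set c := r ^+ 2 - _.
  have c0 : 0 <= c := c_ge0 a r ar.
  (* Because [c] factors as [(r - |a|) * (r + |a|)], it is at least [(r - |a|)^2]. *)
  have hle : r - `|a| <= Num.sqrt c.
    rewrite -(ger0_norm (ltW r0)) -sqrtr_sqr ler_wsqrtr// /c subr_sqr expr2.
    rewrite ler_wpM2l// ?(ltW r0)//.
    by rewrite lerD2l (le_trans _ (normr_ge0 a))// oppr_le0.
  have h0 : 0 < Num.sqrt c := lt_le_trans r0 hle.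
  rewrite -(sqr_sqrtr c0) (le_trans (HK _ h0 _))//.
    by rewrite (le_trans _ hle)// lerBrDr.
  (* It suffices that [K / eps + |a| <= r]. *)
  rewrite ler_pdivrMr// mulrC -ler_pdivrMr// (le_trans _ hle)// lerBrDr.
  by near: r; apply: nbhs_pinfty_ge; exact: num_real.
- move=> nE a r r' ar ar'; rewrite !(pizzaE hdot hb muE hT0)//.
  have par : #|` E| = \dim {:V} %[mod 2] by rewrite nE.
  have two0 : (2 : R) != 0 by rewrite pnatr_eq0.
  apply: (mulfI two0).
  rewrite !(coxeter_ballint_rho hdot hb muE a par) ?c_ge0//.
  set c := r ^+ 2 - _; set c' := r' ^+ 2 - _.
  have bp d : bounded_measurable b (fun x =>
      arrangement_sign dot E x * (power_sum_poly d (\dim {:V})).[unit_dot dot a x]).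
    apply: bm_mul; first exact: bm_arrangement_sign.
    by apply: bm_horner; exact: (bm_unit_dot hdot hb).
  (* The leading terms cancel in the difference of the two polynomials, so its size is at most the
     number of hyperplanes and its integral vanishes. *)
  apply/eqP; rewrite -subr_eq0 -mulN1r -(ballintZ hdot hb muE _ (bp c')).
  rewrite -(ballintD hdot hb muE (bp c)); last by apply: bm_mul => //; exact: bm_cst.
  rewrite (_ : (fun x => _) = fun x => arrangement_sign dot E x *
      (power_sum_poly c (\dim {:V}) - power_sum_poly c' (\dim {:V})).[unit_dot dot a x]).
    by rewrite (coxeter_ballint_poly_eq0 hdot hb muE hE)// nE size_power_sum_polyB.
  by apply/funext => x; rewrite hornerD hornerN mulN1r mulrBr.
Unshelve. all: by end_near. Qed.
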